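(* The algebra $\mathcal{A}_n(x)$ is freely generated as an $R$-module by the collection $$\{m_{\mathfrak{u}\mathfrak{v}}=v_{\mathfrak{u}}^*\,m_\lambda\,v_{\mathfrak{v}} : \mathfrak{u},\mathfrak{v}\in\mathfrak{T}_n(\lambda),\ \lambda\text{ a partition of }n\}.$$ Moreover, the following statements hold. (1) The $R$-linear map $*$ defined by $m_{\mathfrak{u}\mathfrak{v}}\mapsto m_{\mathfrak{v}\mathfrak{u}}$, for $\mathfrak{u},\mathfrak{v}\in\mathfrak{T}_n(\lambda)$ and $\lambda$ a partition of $n$, is the algebra anti-involution of $\mathcal{A}_n(x)$ satisfying $e_i\mapsto e_i$ for $i=1,\dots,n-1$. (2) Suppose that $b\in\mathcal{A}_n(x)$. If $\lambda$ is a partition of $n$ and $\mathfrak{u}\in\mathfrak{T}_n(\lambda)$, then there exist $a_{\mathfrak{v}}\in R$, for $\mathfrak{v}\in\mathfrak{T}_n(\lambda)$, such that for all $\mathfrak{s}\in\mathfrak{T}_n(\lambda)$ $$m_{\mathfrak{s}\mathfrak{u}}\,b\equiv\sum_{\mathfrak{v}\in\mathfrak{T}_n(\lambda)}a_{\mathfrak{v}}\,m_{\mathfrak{s}\mathfrak{v}}\mod \check{\mathcal{A}}_n^\lambda .$$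
   Context: Let $x$ be an indeterminate and $R=\mathbb{Z}[x]$. The Temperley–Lieb algebra $\mathcal{A}_n(x)$ is the unital associative $R$-algebra generated by $e_1,\dots,e_{n-1}$ subject to $e_i^2=xe_i$; $e_ie_{i\pm1}e_i=e_i$ (whenever both indices lie in $\{1,\dots,n-1\}$); $e_ie_j=e_je_i$ for $|i-j|\ge2$. By convention $\mathcal{A}_1(x)=R$, and $\mathcal{A}_i(x)$ is regarded as the subalgebra of $\mathcal{A}_{i+1}(x)$ generated by $e_1,\dots,e_{i-1}$. A partition of $n$ means a pair of integers $(i,n-2i)$ with $0\le 2i\le n$. For partitions $\lambda=(i,n-2i)$, $\mu=(j,n-2j)$ of $n$, $\lambda\unrhd\mu$ means $i\ge j$, and $\lambda\rhd\mu$ means $\lambda\unrhd\mu$ and $\lambda\ne\mu$. If $\mu$ is a partition of $n-1$ and $\lambda=(i,n-2i)$ is a partition of $n$, write $\mu\to\lambda$ if $\mu=(i,n-2i-1)$ or $\mu=(i-1,n-2i+1)$. For $\lambda$ a partition of $n$, $\mathfrak{T}_n(\lambda)$ is the set of sequences $(\lambda^{(0)},\dots,\lambda^{(n)})$, with $\lambda^{(k)}$ a partition of $k$, such that $\lambda^{(0)}=(0,0)$, $\lambda^{(k-1)}\to\lambda^{(k)}$ for $k=1,\dots,n$, and $\lambda^{(n)}=\lambda$. For $\mathfrak{s}=(\lambda^{(0)},\dots,\lambda^{(n)})$ write $\mathrm{Shape}(\mathfrak{s})=\lambda^{(n)}$ and $\mathfrak{s}|_k=(\lambda^{(0)},\dots,\lambda^{(k)})$.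 For $\lambda=(f,n-2f)$ let $m_\lambda=e_1e_3\cdots e_{2f-1}$ ($m_\lambda=1$ if $f=0$). $\mathcal{A}_n^\lambda$ is the two-sided ideal of $\mathcal{A}_n(x)$ generated by $m_\lambda$ and $\check{\mathcal{A}}_n^\lambda=\sum_{\mu\rhd\lambda}\mathcal{A}_n^\mu$. Define $w_{i,j}=e_ie_{i+1}\cdots e_{j-1}$ if $i<j$, $w_{i,j}=e_{i-1}e_{i-2}\cdots e_j$ if $j<i$, and $w_{i,i}=1$. Define $v_{\mathfrak{t}}$ and $v_{\mathfrak{t}}^*$ recursively: $v_{\mathfrak{t}}=v_{\mathfrak{t}}^*=1$ if $\mathfrak{t}=((0,0))$; if $\mathfrak{t}\in\mathfrak{T}_n(\lambda)$, $\lambda=(f,n-2f)$, $\mathfrak{s}=\mathfrak{t}|_{n-1}$, then $v_{\mathfrak{t}}=v_{\mathfrak{s}}$, $v^*_{\mathfrak{t}}=v^*_{\mathfrak{s}}$ if $\mathrm{Shape}(\mathfrak{s})=(f,n-2f-1)$, and $v_{\mathfrak{t}}=w_{2f,n}v_{\mathfrak{s}}$, $v_{\mathfrak{t}}^*=v_{\mathfrak{s}}^*w_{n,2f}$ if $\mathrm{Shape}(\mathfrak{s})=(f-1,n-2f+1)$. *)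

(* Defs.v *)
(* The only non-constructive ingredient is [boolp.asbool], used to
   quotient by a two-sided ideal whose membership is not decidable a priori. *)
From HB Require Import structures.
From mathcomp Require Import all_boot all_order all_algebra.
From mathcomp Require Import boolp monalg.

Set Implicit Arguments.
Unset Strict Implicit.
Unset Printing Implicit Defensive.

Import GRing.Theory.
Local Open Scope ring_scope.
Local Open Scope quotient_scope.

Definition ideal_gen (A : pzRingType) (S : A -> Prop) (a : A) : Prop :=
  exists2 s : seq (A * A * A),
    forall t, t \in s -> S t.1.2 & a = \sum_(t <- s) t.1.1 * t.1.2 * t.2.

Definition freely_generated (R : pzRingType) (V : lmodType R) (I : finType)
    (b : I -> V) : Prop :=
  (forall a : V, exists c : I -> R, a = \sum_i c i *: b i) /\
  (forall c : I -> R, \sum_i c i *: b i = 0 -> forall i, c i = 0).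

Section IdealGenTheory.
Variables (A : pzRingType) (S : A -> Prop).

Lemma ideal_gen0 : ideal_gen S 0.
Proof. by exists [::]; rewrite ?big_nil. Qed.

Lemma ideal_genD a b : ideal_gen S a -> ideal_gen S b -> ideal_gen S (a + b).
Proof.
move=> [s hs ->] [t ht ->]; exists (s ++ t); last by rewrite big_cat.
by move=> x; rewrite mem_cat => /orP[/hs|/ht].
Qed.

Lemma ideal_gen_mul c d a : ideal_gen S a -> ideal_gen S (c * a * d).
Proof.
move=> [s hs ->]; exists [seq (c * t.1.1, t.1.2, t.2 * d) | t <- s].
  by move=> _ /mapP[t /hs ht ->].
rewrite big_map mulr_sumr mulr_suml; apply: eq_bigr => t _ /=.
by rewrite !mulrA.
Qed.

Lemma ideal_genMl c a : ideal_gen S a -> ideal_gen S (c * a).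
Proof. by move=> /(ideal_gen_mul c 1); rewrite mulr1. Qed.

Lemma ideal_genMr c a : ideal_gen S a -> ideal_gen S (a * c).
Proof. by move=> /(ideal_gen_mul 1 c); rewrite mul1r. Qed.

End IdealGenTheory.

Section FreeAlgebra.
Variables (R : comNzRingType) (I : choiceType).

(* monalg only equips commutative monoid algebras with this structure. *)
Lemma fmalg_scalerAr (c : R) (a b : {malg R[{fmonom I}]}) :
  c *: (a * b) = a * (c *: b).
Proof.
apply/malgP => k; rewrite mcoeffZ mcoeffMl.
rewrite (mcoeffMlw k (finmap.fsubset_refl (msupp a)) (msuppZ_le c b)) mulr_sumr.
apply: eq_bigr => k1 _; rewrite mulr_sumr; apply: eq_bigr => k2 _.
by rewrite mcoeffZ mulrnAr !mulrA [c * _]mulrC.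
Qed.

End FreeAlgebra.

(* The free associative Z[x]-algebra on n - 1 letters. *)
Definition TLfree (n : nat) : Type := {malg {poly int}[{fmonom 'I_n.-1}]}.

HB.instance Definition _ n := GRing.Lalgebra.on (TLfree n).

(* The letters are numbered from 1 as in the presentation: [TLletter n i] is
   the letter of index i - 1 in 'I_n.-1 if 1 <= i <= n - 1, and the junk value 0
   otherwise. *)
Definition TLletter (n i : nat) : TLfree n :=
  if i is i'.+1 then
    oapp (fun j : 'I_n.-1 => (<< fmu j >> : TLfree n)) 0 (insub i')
  else 0.

(* [TLrel n r] : the element r has to vanish in the Temperley-Lieb algebra. *)
Inductive TLrel (n : nat) : TLfree n -> Prop :=
| TLrel_sqr i : (0 < i < n)%N ->
    TLrel (TLletter n i ^+ 2 - 'X *: TLletter n i)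
| TLrel_braid i j : (0 < i < n)%N -> (0 < j < n)%N ->
    (j == i.+1) || (i == j.+1) ->
    TLrel (TLletter n i * TLletter n j * TLletter n i - TLletter n i)
| TLrel_comm i j : (0 < i < n)%N -> (0 < j < n)%N ->
    (i + 2 <= j)%N || (j + 2 <= i)%N ->
    TLrel (TLletter n i * TLletter n j - TLletter n j * TLletter n i).

Section TLQuotient.
Variable n : nat.

Definition TLideal : {pred TLfree n} :=
  fun a => `[< ideal_gen (@TLrel n) a >].

Lemma TLidealP a : reflect (ideal_gen (@TLrel n) a) (a \in TLideal).
Proof. exact: asboolP. Qed.

Lemma TLidealMl c a : a \in TLideal -> c * a \in TLideal.
Proof. by move=> /TLidealP ha; apply/TLidealP/ideal_genMl. Qed.

Lemma TLidealMr c a : a \in TLideal -> a * c \in TLideal.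
Proof. by move=> /TLidealP ha; apply/TLidealP/ideal_genMr. Qed.

Lemma TLidealZ (c : {poly int}) a : a \in TLideal -> c *: a \in TLideal.
Proof. by rewrite -[a]mul1r scalerAl mul1r; apply: TLidealMl. Qed.

Lemma TLideal_zmod : zmod_closed TLideal.
Proof.
split=> [|a b /TLidealP ha /TLidealP hb]; first exact/TLidealP/ideal_gen0.
apply/TLidealP; rewrite -mulN1r; apply: ideal_genD => //.
exact: ideal_genMl.
Qed.

HB.instance Definition _ := GRing.isZmodClosed.Build (TLfree n) TLideal
  TLideal_zmod.

(* The augmentation (constant term) kills every relation, so the quotient is
   nontrivial. *)
Lemma TLideal1 : 1 \notin TLideal.
Proof.
pose aug : {rmorphism TLfree n -> {poly int}} :=
  mcoeff (mone : {fmonom 'I_n.-1}).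
have aug_letter i : aug (TLletter n i) = 0.
  case: i => [|i] /=; first exact: raddf0.
  case: insubP => [j _ _|_] /=; last exact: raddf0.
  rewrite mcoeffU1; case: eqP => // /(congr1 (@fmonom_val _)).
  by rewrite fm1 fmuE.
have augM a b : aug (a * b) = aug a * aug b by exact: rmorphM.
have augB a b : aug (a - b) = aug a - aug b by exact: raddfB.
have augZ c a : aug (c *: a) = c * aug a by exact: mcoeffZ.
have aug_rel r : TLrel r -> aug r = 0.
  by case=> *; rewrite augB ?expr2 !(augM, augZ) !aug_letter !mulr0 subrr.
apply/TLidealP => -[s hs] /(congr1 aug); rewrite rmorph1.
rewrite raddf_sum big_seq big1 => [|t /hs /aug_rel ht]; first by move/eqP; rewrite oner_eq0.
by rewrite /= !augM ht mulr0 mul0r.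
Qed.

Definition TL : Type := Quotient.quot TLideal.

HB.instance Definition _ := GRing.Zmodule.on TL.

Definition TLpi (a : TLfree n) : TL := \pi_(Quotient.quot TLideal) a.

Lemma TLpi_eq a b : TLpi a = TLpi b <-> a - b \in TLideal.
Proof. by rewrite Quotient.idealrBE; split => [/eqP|/eqP]. Qed.

Lemma TLpi_repr (u : TL) : TLpi (repr u) = u.
Proof. exact: reprK. Qed.

Lemma TLpiD a b : TLpi (a + b) = TLpi a + TLpi b.
Proof. exact: raddfD. Qed.

Definition TLone : TL := TLpi 1.
Definition TLmul (u v : TL) : TL := TLpi (repr u * repr v).
Definition TLscale (c : {poly int}) (u : TL) : TL := TLpi (c *: repr u).

Lemma TLpiM a b : TLmul (TLpi a) (TLpi b) = TLpi (a * b).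
Proof.
apply/TLpi_eq; set a' := repr _; set b' := repr _.
have -> : a' * b' - a * b = (a' - a) * b' + a * (b' - b).
  by rewrite mulrBl mulrBr addrA subrK.
have ha : a' - a \in TLideal by apply/TLpi_eq; rewrite TLpi_repr.
have hb : b' - b \in TLideal by apply/TLpi_eq; rewrite TLpi_repr.
by apply: rpredD; [apply: TLidealMr | apply: TLidealMl].
Qed.

Lemma TLpiZ c a : TLscale c (TLpi a) = TLpi (c *: a).
Proof.
apply/TLpi_eq; rewrite -scalerBr; apply: TLidealZ.
by apply/TLpi_eq; rewrite TLpi_repr.
Qed.

Lemma TLmulA : associative TLmul.
Proof.
move=> u v w; rewrite -[u]TLpi_repr -[v]TLpi_repr -[w]TLpi_repr.
by rewrite !TLpiM mulrA.
Qed.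

Lemma TLmul1 : left_id TLone TLmul.
Proof. by move=> u; rewrite -[u]TLpi_repr TLpiM mul1r. Qed.

Lemma TL1mul : right_id TLone TLmul.
Proof. by move=> u; rewrite -[u]TLpi_repr TLpiM mulr1. Qed.

Lemma TLmulDl : left_distributive TLmul +%R.
Proof.
move=> u v w; rewrite -[u]TLpi_repr -[v]TLpi_repr -[w]TLpi_repr.
by rewrite -TLpiD !TLpiM -TLpiD mulrDl.
Qed.

Lemma TLmulDr : right_distributive TLmul +%R.
Proof.
move=> u v w; rewrite -[u]TLpi_repr -[v]TLpi_repr -[w]TLpi_repr.
by rewrite -TLpiD !TLpiM -TLpiD mulrDr.
Qed.

Lemma TLone_neq0 : TLone != 0.
Proof.
apply: contraNneq TLideal1 => /eqP; rewrite -(raddf0 TLpi) => /eqP/TLpi_eq.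
by rewrite subr0.
Qed.

HB.instance Definition _ := GRing.Zmodule_isNzRing.Build TL
  TLmulA TLmul1 TL1mul TLmulDl TLmulDr TLone_neq0.

Lemma TLscaleA c d (u : TL) : TLscale c (TLscale d u) = TLscale (c * d) u.
Proof. by rewrite -[u]TLpi_repr !TLpiZ scalerA. Qed.

Lemma TLscale1 : left_id 1 TLscale.
Proof. by move=> u; rewrite -[u]TLpi_repr TLpiZ scale1r. Qed.

Lemma TLscaleDr : right_distributive TLscale +%R.
Proof.
move=> c u v; rewrite -[u]TLpi_repr -[v]TLpi_repr.
by rewrite -TLpiD !TLpiZ -TLpiD scalerDr.
Qed.

Lemma TLscaleDl (u : TL) : {morph TLscale^~ u : c d / c + d}.
Proof. by move=> c d; rewrite -[u]TLpi_repr !TLpiZ -TLpiD scalerDl. Qed.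

HB.instance Definition _ := GRing.Zmodule_isLmodule.Build {poly int} TL
  TLscaleA TLscale1 TLscaleDr TLscaleDl.

Lemma TLscaleAl (c : {poly int}) (u v : TL) : c *: (u * v) = (c *: u) * v.
Proof.
rewrite -[u]TLpi_repr -[v]TLpi_repr.
by rewrite /GRing.mul /GRing.scale /= TLpiM !TLpiZ TLpiM -scalerAl.
Qed.

HB.instance Definition _ := GRing.Lmodule_isLalgebra.Build {poly int} TL
  TLscaleAl.

Lemma TLscaleAr (c : {poly int}) (u v : TL) : c *: (u * v) = u * (c *: v).
Proof.
rewrite -[u]TLpi_repr -[v]TLpi_repr.
by rewrite /GRing.mul /GRing.scale /= TLpiM !TLpiZ TLpiM fmalg_scalerAr.
Qed.

HB.instance Definition _ := GRing.Lalgebra_isAlgebra.Build {poly int} TL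
  TLscaleAr.

Definition TLgen (i : nat) : TL := TLpi (TLletter n i).

End TLQuotient.

Definition part_of (n : nat) (p : nat * nat) : bool := (p.2 + 2 * p.1 == n)%N.

(* The partitions of n: pairs (i, n - 2i) of natural numbers with 2i <= n. *)
Definition tlpart (n : nat) : Type :=
  {p : 'I_n.+1 * 'I_n.+1 | part_of n (val p.1, val p.2)}.

HB.instance Definition _ n := Finite.on (tlpart n).

Definition part_pair (n : nat) (lam : tlpart n) : nat * nat :=
  (val (val lam).1, val (val lam).2).

Definition pdom (n : nat) (lam mu : tlpart n) : bool :=
  ((part_pair mu).1 <= (part_pair lam).1)%N.

Definition psdom (n : nat) (lam mu : tlpart n) : bool :=
  pdom lam mu && (lam != mu).

(* For mu a partition of n - 1 and lam = (i, n - 2i):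
   mu = (i, n - 2i - 1) or mu = (i - 1, n - 2i + 1), written without truncated
   subtraction. *)
Definition parrow (mu lam : nat * nat) : bool :=
  (mu.1 == lam.1) && (mu.2.+1 == lam.2) ||
  (mu.1.+1 == lam.1) && (mu.2 == lam.2.+1).

(* [path_at t k] is the entry lambda^(k), 0 <= k <= n, of the sequence t. *)
Definition path_at (n : nat) (t : n.+1.-tuple ('I_n.+1 * 'I_n.+1)) (k : nat) :
    nat * nat :=
  let p := nth (ord0, ord0) t k in (val p.1, val p.2).

Definition is_tableau (n : nat) (lam : tlpart n)
    (t : n.+1.-tuple ('I_n.+1 * 'I_n.+1)) : bool :=
  [&& [forall k : 'I_n.+1, part_of k (path_at t k)],
      path_at t 0 == (0, 0)%N,
      [forall k : 'I_n, parrow (path_at t k) (path_at t k.+1)]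
    & path_at t n == part_pair lam].

Definition tableau (n : nat) (lam : tlpart n) : Type :=
  {t : n.+1.-tuple ('I_n.+1 * 'I_n.+1) | is_tableau lam t}.

HB.instance Definition _ n (lam : tlpart n) := Finite.on (tableau lam).

Section Cellular.
Variable n : nat.

(* w_{i,j}; the products are ordered, and empty (hence 1) for i = j. *)
Definition TLw (i j : nat) : TL n :=
  if (i < j)%N then \prod_(i <= k < j) TLgen n k
  else \prod_(k <- rev (index_iota j i)) TLgen n k.

(* [TLv_upto p k] and [TLvstar_upto p k] are v_t and v_t^* for the truncation
   t = (p 0, ..., p k) of the path p; all of them are words in
   e_1, ..., e_{n-1}, so they are formed directly in the algebra on n strands. *)
Fixpoint TLv_upto (p : nat -> nat * nat) (k : nat) : TL n :=
  if k is k'.+1 then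
    if (p k').1 == (p k).1 then TLv_upto p k'
    else TLw (2 * (p k).1) k * TLv_upto p k'
  else 1.

Fixpoint TLvstar_upto (p : nat -> nat * nat) (k : nat) : TL n :=
  if k is k'.+1 then
    if (p k').1 == (p k).1 then TLvstar_upto p k'
    else TLvstar_upto p k' * TLw k (2 * (p k).1)
  else 1.

Definition TLv (lam : tlpart n) (t : tableau lam) : TL n :=
  TLv_upto (path_at (val t)) n.

Definition TLvstar (lam : tlpart n) (t : tableau lam) : TL n :=
  TLvstar_upto (path_at (val t)) n.

(* m_lam = e_1 e_3 ... e_{2f-1} for lam = (f, n - 2f). *)
Definition TLm (lam : tlpart n) : TL n :=
  \prod_(0 <= k < (part_pair lam).1) TLgen n (2 * k).+1.

Definition TLmuv (lam : tlpart n) (u v : tableau lam) : TL n :=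
  TLvstar u * TLm lam * TLv v.

Definition muv_index : finType :=
  {lam : tlpart n & (tableau lam * tableau lam)%type}.

Definition TLmuv_family (i : muv_index) : TL n :=
  TLmuv (tagged i).1 (tagged i).2.

Definition TLcell_ideal (lam : tlpart n) : TL n -> Prop :=
  ideal_gen (fun m => m = TLm lam).

Definition TLcheck_ideal (lam : tlpart n) (a : TL n) : Prop :=
  exists2 b : tlpart n -> TL n,
    forall mu, psdom mu lam -> TLcell_ideal mu (b mu) &
    a = \sum_(mu | psdom mu lam) b mu.

Definition anti_involution (f : TL n -> TL n) : Prop :=
  [/\ f 1 = 1, forall a b, f (a * b) = f b * f a & involutive f].

End Cellular.

(* Main.v *)
(* Words w : nat -> bool encode tableaux: w j = true when step j + 1 of the path
   raises the first entry, so tableaux are the ballot words.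

   Spanning: m_lambda v_t satisfies a single exchange rule: multiplying on the
   right by e_(i+1) turns letters 10 at positions i, i + 1 into 01.  The defining
   relations then give the action of every generator on the m_lambda v_t modulo
   the ideals of larger shapes, by induction on the words; hence (2), and the
   spanning property by downward induction on the shape.

   Independence: TL_n acts on functions on words with values in
   Z[x][t]/(t^2 - x t + 1), each e_i by a rank-one symmetric matrix on the letters
   01, 10 (the spin-chain representation).  By the same exchange rule, the matrix
   entry of m_uv at the words (r, s) vanishes unless u <= r and v <= s in dominance
   order, and at (u, v) it is the unit t^f. *)
From HB Require Import structures.
Require Import Defs.
From mathcomp Require Import all_boot all_order all_algebra.
From mathcomp Require Import boolp monalg.
From mathcomp Require Import zify ring.

Set Implicit Arguments.
Unset Strict Implicit.
Unset Printing Implicit Defensive.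

Import GRing.Theory.
Local Open Scope ring_scope.


(** Only right multiplication is analysed. Reversal of words respects the defining relations, so it
    gives an anti-involution that carries every statement to the left side: it exchanges m_uv and
    m_vu, and in the spin-chain representation it is matrix transposition. The exchange rule becomes
    visible once m_lambda is absorbed into v_t. Each factor is then a run of consecutive generators
    starting at its own cup, and multiplying by a generator lengthens such a run or triggers one of
    the relations. The quadratic extension is forced: a symmetric block [[a, 1], [1, b]] with
    commuting entries squares to x times itself exactly when ab = 1 and a + b = x. The entries 1 off
    the diagonal are what preserves leading coefficients. Independence needs neither diagrams nor a
    dimension count: all shapes are handled together by one triangularity argument. *)

Definition word := nat -> bool.

Implicit Types (w : word).

(** * Ballot words, adjacent swaps and the defect *)

Fixpoint cnt w (k : nat) : nat := if k is k'.+1 then (cnt w k' + w k')%N else 0%N.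

Lemma cntS w k : cnt w k.+1 = (cnt w k + w k)%N.
Proof. by []. Qed.

Definition swap (i : nat) w : word :=
  fun j => if j == i then w i.+1 else if j == i.+1 then w i else w j.

Definition ballot (n : nat) w : Prop := forall k, (k <= n)%N -> (2 * cnt w k <= k)%N.

Lemma swapK i : involutive (swap i).
Proof.
move=> w; apply/funext => j; rewrite /swap eqxx.
by do ![case: eqP => //] => *; subst; lia.
Qed.

Lemma swap_l i w : swap i w i = w i.+1.
Proof. by rewrite /swap eqxx. Qed.

Lemma swap_r i w : swap i w i.+1 = w i.
Proof. by rewrite /swap eqxx; case: eqP => // h; lia. Qed.

Lemma swap_out i w j : j <> i -> j <> i.+1 -> swap i w j = w j.
Proof. by rewrite /swap => /eqP/negbTE -> /eqP/negbTE ->. Qed.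

Lemma swap_comm i j w : (i.+1 < j)%N -> swap i (swap j w) = swap j (swap i w).
Proof.
move=> hij; apply/funext => k; rewrite /swap.
by do ![case: eqP => //]; lia.
Qed.

Lemma eq_cnt w w' k : (forall j, (j < k)%N -> w j = w' j) -> cnt w k = cnt w' k.
Proof.
elim: k => //= k IH h; rewrite h // IH // => j hj; apply: h; lia.
Qed.

Lemma cnt_swap i w k : k <> i.+1 -> cnt (swap i w) k = cnt w k.
Proof.
move=> hk; case: (ltngtP k i.+1) => // [lt_ki|lt_ik].
  by apply: eq_cnt => j hj; apply: swap_out; lia.
elim: k lt_ik {hk} => // k IH lt_ik; rewrite ltnS leq_eqVlt in lt_ik.
case/orP: lt_ik => [/eqP <- |lt_ik] /=; last by rewrite IH // swap_out //; lia.
rewrite swap_l swap_r (@eq_cnt (swap i w) w) => [|j hj]; last by apply: swap_out; lia.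
lia.
Qed.

Lemma cnt_swapS i w : cnt (swap i w) i.+1 = (cnt w i + w i.+1)%N.
Proof. by rewrite /= cnt_swap ?swap_l //; lia. Qed.

Lemma cnt_mono w k l : (k <= l)%N -> (cnt w k <= cnt w l)%N.
Proof.
elim: l => [|l IH]; first by rewrite leqn0 => /eqP ->.
by rewrite leq_eqVlt => /orP[/eqP -> //|/IH h] /=; lia.
Qed.

Lemma cnt_const w k l b : (k <= l)%N ->
  (forall j, (k <= j < l)%N -> w j = b) -> cnt w l = (cnt w k + b * (l - k))%N.
Proof.
elim: l => [|l IH] hkl h; first by move: hkl; rewrite leqn0 => /eqP ->; rewrite muln0.
case: (ltngtP k l.+1) hkl => // [hk _|-> _]; last by rewrite subnn muln0 addn0.
have IHl : cnt w l = (cnt w k + b * (l - k))%N.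
  by apply: IH => // j hj; apply: h; lia.
have wl : w l = b by apply: h; lia.
by rewrite /= IHl wl; case: b {h IH IHl wl}; lia.
Qed.

(** An area statistic: raising a single partial count by one lowers it by one. The subtraction is
    truncated, which is harmless for ballot words. *)
Definition defect (n : nat) w : nat := \sum_(k < n) (k - cnt w k).

Lemma defect_swap n i w : (i.+1 < n)%N -> ballot n w -> ballot n (swap i w) ->
  w i = false -> w i.+1 = true -> defect n w = (defect n (swap i w)).+1.
Proof.
move=> hi bw bs wi wi1; rewrite /defect.
rewrite (bigD1 (Ordinal hi)) //= [in RHS](bigD1 (Ordinal hi)) //=.
rewrite [in RHS](eq_bigr (fun k : 'I_n => (k - cnt w k)%N)) => [|k /eqP hk]; last first.
  by rewrite cnt_swap // => hki; apply: hk; apply: val_inj.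
have := bs i.+1 (ltnW hi); rewrite -!/(cnt _ _.+1) cnt_swapS wi1 /= wi.
lia.
Qed.

(** * Right action of the generators on m_lambda v_t, with [g i] standing for e_(i+1) *)

Section CellModule.
Variables (R : comNzRingType) (x : R) (A : algType R) (n : nat) (g : nat -> A).
Hypothesis g_sqr : forall i, (i.+1 < n)%N -> g i * g i = x *: g i.
Hypothesis g_braid : forall i j, (i.+1 < n)%N -> (j.+1 < n)%N ->
  (j == i.+1) || (i == j.+1) -> g i * g j * g i = g i.
Hypothesis g_comm : forall i j, (i.+1 < n)%N -> (j.+1 < n)%N ->
  (i.+1 < j)%N || (j.+1 < i)%N -> GRing.comm (g i) (g j).

Definition seg (a b : nat) : A := \prod_(a <= j < b) g j.

Definition cups (f : nat) : A := \prod_(0 <= k < f) g (2 * k).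

Fixpoint vword w (k : nat) : A :=
  if k is k'.+1 then
    if w k' then seg (2 * cnt w k').+1 k' * vword w k' else vword w k'
  else 1.

(** This is m_lambda v_t with each cup absorbed into the factor of its raising step: the segment
    starts at 2 cnt instead of 2 cnt + 1. *)
Fixpoint yword w (k : nat) : A :=
  if k is k'.+1 then
    if w k' then seg (2 * cnt w k') k' * yword w k' else yword w k'
  else 1.

Lemma eq_vword w w' k : (forall j, (j < k)%N -> w j = w' j) ->
  vword w k = vword w' k.
Proof.
elim: k => // k IH h; have hk : forall j, (j < k)%N -> w j = w' j.
  by move=> j hj; apply: h; apply: ltnW.
by rewrite /= IH // h // (eq_cnt hk).
Qed.

Lemma comm_seg i a b : (i.+1 < n)%N -> (b < n)%N ->
  (b < i)%N || (i.+1 < a)%N -> GRing.comm (g i) (seg a b).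
Proof.
move=> hi hb hab; rewrite /seg big_nat; apply: commr_prod => j hj.
by apply: g_comm; lia.
Qed.

Lemma comm_cups i f : (i.+1 < n)%N -> (2 * f <= i)%N -> GRing.comm (g i) (cups f).
Proof.
move=> hi hf; rewrite /cups big_nat; apply: commr_prod => k hk.
by apply: g_comm; lia.
Qed.

Lemma seg_comm_cups a b f : (b < n)%N -> (2 * f <= a)%N ->
  GRing.comm (seg a b) (cups f).
Proof.
move=> hb hf; apply: commr_sym; rewrite /seg big_nat; apply: commr_prod => j hj.
by apply/commr_sym/comm_cups; lia.
Qed.

Lemma comm_yword i w k : (i.+1 < n)%N -> (k <= i)%N -> GRing.comm (g i) (yword w k).
Proof.
move=> hi; elim: k => [|k IH] hk /=; first exact: commr1.
have {}IH := IH (ltnW hk); case: ifP => // _.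
by apply: commrM => //; apply: comm_seg; lia.
Qed.

(** The newest cup completes the newest segment; the older cups have indices smaller by at least two
    and commute past it. *)
Lemma cups_vword w k : ballot n w -> (k <= n)%N ->
  cups (cnt w k) * vword w k = yword w k.
Proof.
move=> bw; elim: k => [|k IH] hk /=; first by rewrite /cups big_geq // mulr1.
have {IH} <- := IH (ltnW hk).
case wk : (w k); last by rewrite addn0.
have := bw _ hk; rewrite /= wk => hc.
rewrite addn1 /cups big_nat_recr //= -/(cups _) !mulrA; congr (_ * _).
rewrite -mulrA; have -> : g (2 * cnt w k) * seg (2 * cnt w k).+1 k = seg (2 * cnt w k) k.
  by rewrite /seg [RHS]big_ltn //; lia.
by apply/commr_sym/seg_comm_cups; lia.
Qed.

(** Later factors are multiplied on the left and see the earlier letters only through their count,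
    so an identity with right multipliers at level k propagates upwards. *)
Lemma yword_suffix w w' k a b : (forall j, (k <= j)%N -> w j = w' j) ->
  cnt w k = cnt w' k -> yword w k * a = yword w' k * b ->
  forall l, (k <= l)%N -> yword w l * a = yword w' l * b.
Proof.
move=> eqw eqc eqy l; elim: l => [|l IH] hkl; first by move: hkl eqy; case: (k).
move: hkl; rewrite leq_eqVlt ltnS => /orP[/eqP <- //|hkl] /=.
have eqcl : cnt w l = cnt w' l.
  elim: l hkl {IH} => [|l IH hkl]; first by move: eqc; case: (k).
  move: hkl; rewrite leq_eqVlt ltnS => /orP[/eqP <- //|hkl] /=.
  by rewrite IH // eqw.
by rewrite eqw // eqcl; case: ifP => _; rewrite -?mulrA IH.
Qed.

(** Moving the 1 from i to i + 1 lengthens its segment by [g i], which reaches the end of that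
    segment by commuting past [yword w i]: the generators there have index at most i - 2. *)
Lemma yword_delay w i : (i.+1 < n)%N -> (2 * cnt w i <= i)%N ->
  w i = true -> w i.+1 = false -> yword w n * g i = yword (swap i w) n.
Proof.
move=> hi hc wi wi1; rewrite -[RHS]mulr1.
apply: (@yword_suffix _ _ i.+2) => // [j hj||].
- by rewrite swap_out //; lia.
- by rewrite cnt_swap //; lia.
have y_eq : forall k, (k <= i)%N -> yword (swap i w) k = yword w k.
  elim=> //= k IH hk; rewrite cnt_swap ?swap_out ?IH //; lia.
rewrite /= swap_l swap_r wi wi1 /= cnt_swap; last by lia.
rewrite addn0 mulr1 y_eq // /seg big_nat_recr //=.
by rewrite -!mulrA (comm_yword w hi).
Qed.

Lemma yword_up w i : (i.+1 < n)%N -> (2 * cnt w i <= i)%N ->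
  w i = false -> w i.+1 = true -> yword w n = yword (swap i w) n * g i.
Proof.
move=> hi hc wi wi1; rewrite yword_delay ?swapK ?swap_l ?swap_r //.
by rewrite cnt_swap //; lia.
Qed.

Lemma yword_loop w i : (i.+1 < n)%N -> (2 * cnt w i <= i)%N ->
  w i = false -> w i.+1 = true -> yword w n * g i = x *: yword w n.
Proof.
by move=> hi hc wi wi1; rewrite (yword_up hi) // -mulrA g_sqr // scalerAr.
Qed.

(** Two exchanges write [yword w n] as y g_i g_(i+1), where y belongs to the pattern 100;
    multiplication by g_i then gives a braid relation. The pattern 100 may violate the ballot
    condition, hence only a bound at i is assumed. The same happens in [yword_011] with the pattern
    110. *)
Lemma yword_001 w i : (i.+2 < n)%N -> (2 * cnt w i <= i)%N ->
  w i = false -> w i.+1 = false -> w i.+2 = true ->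
  yword w n * g i = yword (swap i.+1 w) n.
Proof.
move=> hi hc wi wi1 wi2.
have e1 : yword w n = yword (swap i.+1 w) n * g i.+1.
  by apply: yword_up => //=; rewrite wi; lia.
have e2 : yword (swap i.+1 w) n = yword (swap i (swap i.+1 w)) n * g i.
  apply: yword_up; rewrite ?swap_l ?swap_out ?cnt_swap //; lia.
by rewrite e1 e2 -!mulrA [g i * (_ * _)]mulrA g_braid ?eqxx //; lia.
Qed.

Lemma yword_011 w i : (i.+2 < n)%N -> (2 * (cnt w i).+1 <= i.+1)%N ->
  w i = false -> w i.+1 = true -> w i.+2 = true ->
  yword w n * g i.+1 = yword (swap i w) n.
Proof.
move=> hi hc wi wi1 wi2.
have e1 : yword w n = yword (swap i w) n * g i by apply: yword_up => //; lia.
have e2 : yword (swap i w) n = yword (swap i.+1 (swap i w)) n * g i.+1.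
  apply: yword_up; rewrite ?swap_r ?swap_out ?cnt_swapS ?wi1 //; lia.
by rewrite e1 e2 -!mulrA [g i.+1 * (_ * _)]mulrA g_braid ?eqxx ?orbT //; lia.
Qed.

Section Span.
Variables (J : A -> Prop).
Hypothesis Jmul : forall a b c, J b -> J (a * b * c).
Variable f : nat.
Hypothesis J_cups : (2 * f.+1 <= n)%N -> J (cups f.+1).

(** For i = 2f the product is [cups f.+1]. Beyond that, g_(i+1) = g_(i+1) g_i g_(i+1), and the first
    factor commutes with the cups, so the extra cup slides to the right inside [J]. *)
Lemma cups_gen_ideal i : (i.+1 < n)%N -> (2 * f <= i)%N -> J (cups f * g i).
Proof.
move=> hi; elim: i hi => [|i IH] hi hf.
  have f0 : f = 0%N by lia.
  have := J_cups; rewrite f0 /cups big_nat1 big_geq // mul1r; apply; lia.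
move: hf; rewrite leq_eqVlt => /orP[/eqP hf|hf].
  by rewrite -hf; have := J_cups; rewrite /cups big_nat_recr //=; apply; lia.
have <- : g i.+1 * g i * g i.+1 = g i.+1 by apply: g_braid; lia.
rewrite !mulrA -(comm_cups hi (ltnW hf)) -[g i.+1 * cups f * _]mulrA.
by apply: Jmul; apply: IH; lia.
Qed.

(** [J] stays abstract because it serves twice: as [TLcheck_ideal] for statement (2) and as
    [cups_ideal] for spanning. The bound d on the defect is what lets the induction in [yword_mul]
    close. *)
Inductive cell_span (d : nat) : A -> Prop :=
| Span_word w : ballot n w -> cnt w n = f -> (defect n w <= d)%N ->
    cell_span d (yword w n)
| Span_ideal a : J a -> cell_span d a
| Span_add a b : cell_span d a -> cell_span d b -> cell_span d (a + b)
| Span_scale c a : cell_span d a -> cell_span d (c *: a).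

Lemma cell_span_le d d' a : (d <= d')%N -> cell_span d a -> cell_span d' a.
Proof.
move=> hd; elim=> {a} [w bw cw dw|a|a b _ ha _ hb|c a _ ha].
- by apply: Span_word => //; apply: leq_trans hd.
- exact: Span_ideal.
- exact: Span_add.
- exact: Span_scale.
Qed.

Lemma ballot_swap_up i w : ballot n w -> (2 * (cnt w i).+1 <= i.+1)%N ->
  ballot n (swap i w).
Proof.
move=> bw hc k hk; case: (eqVneq k i.+1) => [->|/eqP hki].
  by rewrite cnt_swapS; case: (w _); lia.
by rewrite cnt_swap //; apply: bw.
Qed.

Lemma ballot_swap_down i w : ballot n w -> w i.+1 = false -> (i < n)%N ->
  ballot n (swap i w).
Proof.
move=> bw wi hi k hk; case: (eqVneq k i.+1) => [->|/eqP hki].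
  by rewrite cnt_swapS wi; have := bw i (ltnW hi); lia.
by rewrite cnt_swap //; apply: bw.
Qed.

(** The pattern 10 is the only one where multiplication by [g i] may raise the defect. This sharp
    bound leaves room for one further multiplication in the inductive step. *)
Definition descent w i : nat := w i && ~~ w i.+1.

Lemma cell_span_mulr d i : (i.+1 < n)%N ->
  (forall w, ballot n w -> cnt w n = f -> (defect n w <= d)%N ->
     cell_span (defect n w + descent w i) (yword w n * g i)) ->
  forall a, cell_span d a -> cell_span d.+1 (a * g i).
Proof.
move=> hi hw a; elim=> {a} [w bw cw dw|a Ja|a b _ ha _ hb|c a _ ha].
- apply: cell_span_le (hw w bw cw dw).
  by rewrite /descent; case: (_ && _); lia.
- by apply: Span_ideal; rewrite -[a]mul1r; apply: Jmul.
- by rewrite mulrDl; apply: Span_add.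
- by rewrite -scalerAl; apply: Span_scale.
Qed.

Lemma last_zero w i : w i = false -> forall k, (i <= k)%N ->
  exists2 j, (i <= j <= k)%N & w j = false /\ forall l, (j < l <= k)%N -> w l = true.
Proof.
move=> wi; elim=> [|k IH] hik.
  exists i; rewrite ?leqnn //; split=> // l; lia.
case wk : (w k.+1); last first.
  by exists k.+1; rewrite ?leqnn ?andbT //; split=> // l; lia.
have {}hik : (i <= k)%N.
  by move: hik; rewrite leq_eqVlt => /orP[/eqP ei|//]; rewrite ei wk in wi.
have [j hj [wj h]] := IH hik; exists j; first by lia.
split=> // l hl; case: (eqVneq l k.+1) => [-> //|hlk]; apply: h; lia.
Qed.

Lemma first_one w i : (forall j, (i <= j < n)%N -> w j = false) \/
  exists2 j, (i <= j < n)%N & w j = true /\ forall l, (i <= l < j)%N -> w l = false.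
Proof.
have [/existsP h|h] := boolP [exists j : 'I_n, (i <= j)%N && w j]; last first.
  left=> j /andP[hij hj]; apply/negP => wj; move/existsP: h; apply.
  by exists (Ordinal hj); rewrite /= hij.
have h' : exists j, [&& (i <= j)%N, (j < n)%N & w j].
  by case: h => j /andP[h1 h2]; exists j; rewrite h1 h2 ltn_ord.
case: (ex_minnP h') => j /and3P[h1 h2 h3] hmin.
right; exists j; first by rewrite h1.
split=> // l /andP[hl1 hl2]; apply/negP => wl.
have := hmin l; rewrite hl1 wl andbT; lia.
Qed.

(* Every case but 00 with no later 1 follows from [yword_delay] and the defining
   relations, after commuting g_i past the generator producing w from a word of
   smaller defect. *)
Lemma yword_mul w i : ballot n w -> cnt w n = f -> (i.+1 < n)%N ->
  cell_span (defect n w + descent w i) (yword w n * g i).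
Proof.
have [d hd] := ubnP (defect n w); elim: d w i hd => // d IHd w i hd bw cw hi.
have bi : (2 * cnt w i <= i)%N by apply: bw; lia.
have up k : (k.+1 < n)%N -> (2 * (cnt w k).+1 <= k.+1)%N -> w k = false ->
    w k.+1 = true -> [/\ ballot n (swap k w), cnt (swap k w) n = f &
                         defect n w = (defect n (swap k w)).+1].
  move=> hk ck wk wk1; have bs := ballot_swap_up bw ck.
  by split=> //; [rewrite cnt_swap //; lia|apply: defect_swap].
(* Here w arises by g_k from a word of defect one less, and g_k commutes with g_i. Without a descent
   at i, multiplying that word by g_i does not raise the defect, and g_k then costs at most one. *)
have step k : (k.+1 < n)%N -> (2 * (cnt w k).+1 <= k.+1)%N -> w k = false ->
    w k.+1 = true -> (k.+1 < i)%N || (i.+1 < k)%N -> w i && ~~ w i.+1 = false ->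
    cell_span (defect n w) (yword w n * g i).
  move=> hk ck wk wk1 hki wi; have [bs cs ds] := up k hk ck wk wk1.
  rewrite (@yword_up w k) //; last by apply: bw; lia.
  rewrite -mulrA (@g_comm k i) // mulrA ds; apply: cell_span_mulr => //.
    by move=> w' bw' cw' dw'; apply: IHd => //; lia.
  have -> : defect n (swap k w) = (defect n (swap k w) + descent (swap k w) i)%N.
    by rewrite /descent !swap_out ?wi ?addn0 //; lia.
  by apply: IHd => //; lia.
rewrite /descent; case wi : (w i); case wi1 : (w i.+1); rewrite ?addn0 /=.
- case: i hi bi step wi wi1 => [|k] hi bi step wi wi1.
    by have := bw 2 hi; rewrite /= wi wi1.
  case wk : (w k); last first.
    have ck : (2 * (cnt w k).+1 <= k.+1)%N.
      by have := bw k.+3 hi; rewrite /= wk wi wi1; lia.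
    have [bs cs ds] := up k (ltnW hi) ck wk wi.
    by rewrite yword_011 //; apply: Span_word => //; lia.
  (* Inside a longer run of 1's: the run begins just after a zero at j, and its second 1 guarantees
     that the first can move left to j without breaking the ballot condition. As j + 1 < i, g_j
     commutes with g_i. *)
  have w0 : w 0%N = false by case w0 : (w 0%N) => //; have := bw 1%N; rewrite /= w0; lia.
  have [j hj [wj hl]] := last_zero w0 (leq0n k).
  have jk : (j < k)%N.
    by case: (eqVneq j k) hj => [ej|]; [rewrite -ej wj in wk|lia].
  have wj1 : w j.+1 = true by apply: hl; lia.
  have wj2 : w j.+2 = true.
    by case: (ltnP j.+1 k) => h; [apply: hl; lia|have -> : j.+2 = k.+1 by lia].
  apply: (step j) => //; [lia| |lia|by rewrite wi wi1].
  by have := bw j.+3; rewrite /= wj wj1 wj2; lia.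
- rewrite yword_delay //; have bs := ballot_swap_down bw wi1 (ltnW hi).
  apply: Span_word => //; first by rewrite cnt_swap //; lia.
  by rewrite (@defect_swap n i (swap i w)) ?swapK ?swap_l ?swap_r //; lia.
- by rewrite yword_loop //; apply/Span_scale/Span_word.
(* With no later 1, all raising steps lie before i, so g_i commutes down to the cups and adds one
   more: the only case where larger shapes enter. *)
case: (first_one w i.+2) => [w_end|[j hj [wj hl]]].
  have zl j : (i <= j < n)%N -> w j = false.
    case: (eqVneq j i) => [-> //|h1]; case: (eqVneq j i.+1) => [-> //|h2] h.
    by apply: w_end; lia.
  have y_end k : (i <= k <= n)%N -> yword w k = yword w i.
    elim: k => [|k IH] hk; first by have -> : i = 0%N by lia.
    case: (eqVneq i k.+1) => [-> //|hik] /=; rewrite IH; last by lia.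
    by rewrite zl //; lia.
  have cwi : cnt w i = f.
    by rewrite -cw (@cnt_const w i n false) ?mul0n ?addn0 //; lia.
  apply: Span_ideal; rewrite y_end; last by lia.
  rewrite -(@comm_yword i w i) // -cups_vword //; last by lia.
  rewrite mulrA comm_cups // cwi -[_ * g i]mul1r; apply: Jmul.
  by apply: cups_gen_ideal => //; rewrite -cwi.
have zl l : (i <= l < j)%N -> w l = false.
  case: (eqVneq l i) => [-> //|h1]; case: (eqVneq l i.+1) => [-> //|h2] h.
  by apply: hl; lia.
case: j hj wj hl zl => // k hk wk1 hl zl.
have wk : w k = false by apply: zl; lia.
have ck : (2 * (cnt w k).+1 <= k.+1)%N.
  rewrite (@cnt_const w i k false); [lia|lia|move=> l hl'; apply: zl; lia].
case: (eqVneq k i.+1) => [eki|hki]; last first.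
  by apply: (step k) => //; [lia|lia|rewrite wi].
rewrite {}eki in hk wk wk1 ck.
have hi2 : (i.+2 < n)%N by lia.
have [bs cs ds] := up i.+1 hi2 ck wk wk1.
by rewrite yword_001 //; apply: Span_word => //; lia.
Qed.

End Span.
End CellModule.

(** * The spin-chain representation and linear independence *)

Section Independence.
Variables (R : comNzRingType) (x : R) (S : algType R) (t t' : S).
Hypothesis tV : t * t' = 1.
Hypothesis t'V : t' * t = 1.
Hypothesis tD : t + t' = x%:A.

(** On the patterns 01, 10 the block is [[t, 1], [1, t']], of determinant 0 and trace x. [S] is not
    assumed commutative, so scalars are kept on the left. *)
Definition hop (i : nat) (phi : word -> S) : word -> S := fun w =>
  if w i == w i.+1 then 0
  else (if w i then t' else t) * phi w + phi (swap i w).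

Lemma hopD i phi psi w :
  hop i (fun w => phi w + psi w) w = hop i phi w + hop i psi w.
Proof. by rewrite /hop; case: ifP => _; rewrite ?addr0 // mulrDr addrACA. Qed.

Lemma hopM i b phi w : b = t \/ b = t' ->
  hop i (fun w => b * phi w) w = b * hop i phi w.
Proof.
move=> hb; rewrite /hop; case: ifP => _; rewrite ?mulr0 // mulrDr !mulrA.
by congr (_ * _ + _); case: hb => ->; case: (w i); rewrite ?tV ?t'V.
Qed.

Definition coef (b : bool) : S := if b then t' else t.

Lemma coef_mul b : coef b * coef (~~ b) = 1.
Proof. by case: b; rewrite /coef /= ?tV ?t'V. Qed.

Lemma coef_mulV b : coef (~~ b) * coef b = 1.
Proof. by rewrite -{2}[b]negbK coef_mul. Qed.

Lemma coef_add b : coef b + coef (~~ b) = x%:A.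
Proof. by case: b; rewrite /coef /= -tD // addrC. Qed.

Lemma hopE i phi w : w i.+1 = ~~ w i ->
  hop i phi w = coef (w i) * phi w + phi (swap i w).
Proof. by move=> e; rewrite /hop e; case: (w i). Qed.

Lemma hop0 i phi w : w i.+1 = w i -> hop i phi w = 0.
Proof. by move=> e; rewrite /hop e eqxx. Qed.

Lemma hop_sqr i phi w : hop i (hop i phi) w = x *: hop i phi w.
Proof.
have [e|/negPf e] := eqVneq (w i.+1) (w i); first by rewrite !hop0 // scaler0.
have {}e : w i.+1 = ~~ w i by move: e; case: (w i); case: (w i.+1).
rewrite !hopE // swap_l ?swap_r ?e ?negbK // swapK.
rewrite -mulr_algl -(coef_add (w i)) mulrDl; congr (_ + _).
by rewrite mulrDr mulrA coef_mulV mul1r addrC.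
Qed.

Lemma hop_comm i j phi w : (i.+1 < j)%N ->
  hop i (hop j phi) w = hop j (hop i phi) w.
Proof.
move=> hij; rewrite /hop !(@swap_out i w j, @swap_out i w j.+1); try lia.
rewrite !(@swap_out j w i, @swap_out j w i.+1); try lia.
rewrite (@swap_comm i j) //.
case: (w i == _); case: (w j == _); rewrite ?mulr0 ?addr0 //.
rewrite !mulrDr !mulrA -!addrA; congr (_ * _ + _).
  by case: (w i); case: (w j); rewrite ?tV ?t'V.
by rewrite addrCA.
Qed.

(** When the letters at i differ, the third letter equals one of them, so in the two outer hops
    every term but one falls on equal letters and vanishes. The remaining diagonal entries cancel by
    t t' = 1. *)
Lemma hop_braidl i phi w : hop i (hop i.+1 (hop i phi)) w = hop i phi w.
Proof.
have [e|/negPf e] := eqVneq (w i.+1) (w i); first by rewrite !hop0.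
have {}e : w i.+1 = ~~ w i by move: e; case: (w i); case: (w i.+1).
have s2 : swap i w i.+2 = w i.+2 by rewrite swap_out //; lia.
have s3 : swap i.+1 (swap i w) i = w i.+1 by rewrite swap_out ?swap_l //; lia.
have s4 : swap i.+1 w i = w i by rewrite swap_out //; lia.
have [e2|/negPf e2] := eqVneq (w i.+2) (w i.+1).
  rewrite hopE // (hop0 _ e2) mulr0 add0r.
  rewrite hopE; last by rewrite swap_r s2 e2 e.
  rewrite [X in _ + X]hop0; last by rewrite swap_l s2 s3.
  rewrite addr0 swap_r hopE ?swap_l ?swap_r ?e ?negbK // swapK.
  by rewrite mulrDr mulrA coef_mul mul1r addrC hopE.
have {}e2 : w i.+2 = w i by move: e2; rewrite e; case: (w i.+2); case: (w i).
rewrite hopE // [X in _ + X]hop0; last by rewrite swap_r s2 e2.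
rewrite addr0 hopE ?e ?e2 ?negbK // [X in _ + X]hop0; last by rewrite swap_l s4 e2.
by rewrite addr0 mulrA coef_mul mul1r.
Qed.

Lemma hop_braidr i phi w : hop i.+1 (hop i (hop i.+1 phi)) w = hop i.+1 phi w.
Proof.
have [e|/negPf e] := eqVneq (w i.+2) (w i.+1); first by rewrite !hop0.
have {}e : w i.+2 = ~~ w i.+1 by move: e; case: (w i.+1); case: (w i.+2).
have s2 : swap i.+1 w i = w i by rewrite swap_out //; lia.
have s3 : swap i (swap i.+1 w) i.+2 = w i.+1 by rewrite swap_out ?swap_r //; lia.
have s4 : swap i w i.+2 = w i.+2 by rewrite swap_out //; lia.
have [e2|/negPf e2] := eqVneq (w i) (w i.+1).
  rewrite hopE // (hop0 _ (esym e2)) mulr0 add0r.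
  rewrite hopE; last by rewrite swap_l s2 e2 e.
  rewrite [X in _ + X]hop0; last by rewrite swap_r s2 s3.
  rewrite addr0 s2 e2 hopE ?swap_l ?swap_r ?e ?negbK // swapK.
  by rewrite mulrDr mulrA coef_mul mul1r addrC hopE.
have {}e2 : w i = w i.+2 by move: e2; rewrite e; case: (w i.+1); case: (w i).
rewrite hopE // [X in _ + X]hop0; last by rewrite swap_l s2 e2.
rewrite addr0 hopE ?e2 ?e ?negbK // [X in _ + X]hop0; last by rewrite swap_r s4 e2.
by rewrite addr0 mulrA coef_mul mul1r.
Qed.

(** A leading term for the dominance order, that is, for the comparison of all partial counts; c is
    allowed to vanish. *)
Definition lead (n : nat) (kap : word) (c : S) (phi : word -> S) : Prop :=
  phi kap = c /\ forall w, phi w <> 0 ->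
    forall k, (k <= n)%N -> (cnt kap k <= cnt w k)%N.

(** The exchange of 10 for 01 uses an off-diagonal entry 1, so c is kept. The diagonal term vanishes
    because [swap i kap] lies strictly below [kap], outside the support of phi. *)
Lemma lead_hop n i kap c phi : (i.+1 < n)%N -> kap i = true -> kap i.+1 = false ->
  lead n kap c phi -> lead n (swap i kap) c (hop i phi).
Proof.
move=> hi ki ki1 [lc lw]; split.
  rewrite hopE ?swap_l ?swap_r ?ki1 ?ki // swapK lc.
  suff -> : phi (swap i kap) = 0 by rewrite mulr0 add0r.
  case: (eqVneq (phi (swap i kap)) 0) => // /eqP/lw/(_ i.+1 (ltnW hi)).
  by rewrite cnt_swapS /= ki ki1; lia.
move=> w hw k hk; have : phi w <> 0 \/ phi (swap i w) <> 0.
  case: (eqVneq (phi w) 0) => [e1|/eqP]; last by left.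
  case: (eqVneq (phi (swap i w)) 0) => [e2|/eqP]; last by right.
  by move: hw; rewrite /hop e1 e2 mulr0 addr0; case: ifP.
case=> /lw h; have hk' := h k hk.
  case: (eqVneq k i.+1) => [ek|/eqP hki]; last by rewrite cnt_swap.
  by move: hk'; rewrite ek cnt_swapS /= ki ki1; lia.
case: (eqVneq k i.+1) => [ek|/eqP hki]; last by move: hk'; rewrite !cnt_swap.
have := h i; rewrite ek cnt_swapS ki1 cnt_swap /=; last by lia.
move=> hi'; apply: leq_trans (leq_addr _ _); rewrite addn0; apply: hi'; lia.
Qed.

Variables (A : algType R) (n : nat) (g : nat -> A).
Variables (rho : A -> (word -> S) -> word -> S) (star : A -> A).
Hypothesis A_ind : forall P : A -> Prop,
  P 1 -> (forall a b, P a -> P b -> P (a + b)) ->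
  (forall c a, P a -> P (c *: a)) ->
  (forall i a, (i.+1 < n)%N -> P a -> P (g i * a)) -> forall a, P a.
Hypothesis rho1 : forall phi w, rho 1 phi w = phi w.
Hypothesis rhoD : forall a b phi w, rho (a + b) phi w = rho a phi w + rho b phi w.
Hypothesis rhoZ : forall c a phi w, rho (c *: a) phi w = c *: rho a phi w.
Hypothesis rhoM : forall a b phi, rho (a * b) phi = rho a (rho b phi).
Hypothesis rhog : forall i phi, (i.+1 < n)%N -> rho (g i) phi = hop i phi.
Hypothesis star1 : star 1 = 1.
Hypothesis starD : forall a b, star (a + b) = star a + star b.
Hypothesis starZ : forall c a, star (c *: a) = c *: star a.
Hypothesis starM : forall a b, star (a * b) = star b * star a.
Hypothesis starg : forall i, (i.+1 < n)%N -> star (g i) = g i.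

Definition delta (s : word) : word -> S := fun w => if `[< w = s >] then 1 else 0.

Lemma delta_id s : delta s s = 1.
Proof. by rewrite /delta asboolT. Qed.

Lemma delta_sym r s : delta s r = delta r s.
Proof. by rewrite /delta; congr (if _ then _ else _); apply/asboolP/asboolP. Qed.

Lemma delta_neq s w : w <> s -> delta s w = 0.
Proof. by move=> h; rewrite /delta asboolF. Qed.

Lemma delta_swap i s w : delta (swap i s) w = delta s (swap i w).
Proof.
rewrite /delta; congr (if _ then _ else _).
by apply/asboolP/asboolP => [->|<-]; rewrite swapK.
Qed.

Lemma hop_delta i r : hop i (delta r) =
  fun w => if r i == r i.+1 then 0 else coef (r i) * delta r w + delta (swap i r) w.
Proof.
apply/funext => w; rewrite delta_swap /hop.
case: (pselect (w = r)) => [-> //|wr]; rewrite (delta_neq wr) !mulr0 !add0r.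
case: (pselect (swap i w = r)) => [<-|wr']; last by rewrite delta_neq //; do 2 case: ifP.
by rewrite swap_l swap_r eq_sym.
Qed.

Lemma rho_addr a phi psi w :
  rho a (fun w => phi w + psi w) w = rho a phi w + rho a psi w.
Proof.
move: a phi psi w; apply: A_ind => [|a b IHa IHb|c a IH|i a hi IH] phi psi w.
- by rewrite !rho1.
- by rewrite !rhoD IHa IHb addrACA.
- by rewrite !rhoZ IH scalerDr.
rewrite !rhoM !rhog //.
have -> : rho a (fun w => phi w + psi w) = fun w => rho a phi w + rho a psi w.
  by apply/funext => v; rewrite IH.
exact: hopD.
Qed.

(** Linearity over t and t' only, since [S] may be noncommutative; these are the scalars that
    [hop_delta] produces. *)
Lemma rho_coefr a b phi w : rho a (fun w => coef b * phi w) w = coef b * rho a phi w.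
Proof.
move: a phi w; apply: A_ind => [|a c IHa IHb|c a IH|i a hi IH] phi w.
- by rewrite !rho1.
- by rewrite !rhoD IHa IHb mulrDr.
- by rewrite !rhoZ IH scalerAr.
rewrite !rhoM !rhog //.
have -> : rho a (fun w => coef b * phi w) = fun w => coef b * rho a phi w.
  by apply/funext => v; rewrite IH.
by apply: hopM; rewrite /coef; case: (b); [right|left].
Qed.

Lemma rho_0r a w : rho a (fun=> 0) w = 0.
Proof.
have /eqP := rho_addr a (fun=> 0) (fun=> 0) w; rewrite addr0.
by rewrite -[X in X == _]addr0 (inj_eq (addrI _)) => /eqP.
Qed.

(** Each [hop] is a symmetric matrix and [star] reverses products, hence [star] is transposition.
    This turns results about the row word into results about the column word. *)
Lemma rho_sym a r s : rho a (delta s) r = rho (star a) (delta r) s.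
Proof.
move: a r s; apply: A_ind => [|a b IHa IHb|c a IH|i a hi IH] r s.
- by rewrite star1 !rho1 delta_sym.
- by rewrite starD !rhoD IHa IHb.
- by rewrite starZ !rhoZ IH.
rewrite starM starg // !rhoM !rhog // hop_delta {1}/hop.
case: ifP => _; first by rewrite rho_0r.
by rewrite rho_addr rho_coefr !IH.
Qed.

Definition rseg (a b : nat) : A := \prod_(j <- rev (index_iota a b)) g j.

Fixpoint vstar w (k : nat) : A :=
  if k is k'.+1 then
    if w k' then vstar w k' * rseg (2 * cnt w k').+1 k' else vstar w k'
  else 1.

Lemma eq_vstar w w' k : (forall j, (j < k)%N -> w j = w' j) ->
  vstar w k = vstar w' k.
Proof.
elim: k => // k IH h; have hk : forall j, (j < k)%N -> w j = w' j.
  by move=> j hj; apply: h; apply: ltnW.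
by rewrite /= IH // h // (eq_cnt hk).
Qed.

Lemma index_iotaS a b : (a <= b)%N -> index_iota a b.+1 = rcons (index_iota a b) b.
Proof. by move=> hab; rewrite /index_iota subSn // -addn1 iotaD /= cats1 subnKC. Qed.

Lemma rsegS a b : (a <= b)%N -> rseg a b.+1 = g b * rseg a b.
Proof. by move=> hab; rewrite /rseg index_iotaS // rev_rcons big_cons. Qed.

Lemma rseg_geq a b : (b <= a)%N -> rseg a b = 1.
Proof. by rewrite -subn_eq0 /rseg /index_iota => /eqP ->; rewrite big_nil. Qed.

Lemma star_rseg a b : (b <= n.-1)%N -> star (rseg a b) = seg g a b.
Proof.
elim: b => [|b IH] hb; first by rewrite rseg_geq // /seg big_geq.
case: (leqP a b) => hab; last by rewrite rseg_geq // /seg big_geq.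
rewrite rsegS // starM starg ?IH /seg ?big_nat_recr //=; lia.
Qed.

Lemma starK : involutive star.
Proof.
apply: A_ind => [|a b IHa IHb|c a IH|i a hi IH]; first by rewrite !star1.
- by rewrite !starD IHa IHb.
- by rewrite !starZ IH.
- by rewrite !starM IH !starg.
Qed.

Lemma star_vstar w k : (k <= n)%N -> star (vstar w k) = vword g w k.
Proof.
elim: k => [|k IH] hk /=; first by [].
case: ifP => _; last by apply: IH; lia.
by rewrite starM star_rseg ?IH //; lia.
Qed.

Lemma star_vword w k : (k <= n)%N -> star (vword g w k) = vstar w k.
Proof. by move=> hk; rewrite -star_vstar // starK. Qed.

Hypothesis g_comm : forall i j, (i.+1 < n)%N -> (j.+1 < n)%N ->
  (i.+1 < j)%N || (j.+1 < i)%N -> GRing.comm (g i) (g j).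

Lemma star_cups f : (2 * f <= n)%N -> star (cups g f) = cups g f.
Proof.
elim: f => [|f IH] hf; first by rewrite /cups big_geq.
rewrite /cups big_nat_recr //= -/(cups g f) starM starg ?IH; [|lia..].
apply: (comm_cups g_comm); lia.
Qed.

(** The word 0101...01 followed by zeros, one pair per cup. Its v_t is 1, so m_lambda is itself one
    of the m_uv. *)
Definition base (f : nat) : word := fun j => odd j && (j < 2 * f)%N.

(* Below k the 1's are packed as in [base]; the factors of v_u^*, applied from
   right to left, move them one after another to their places in w. *)
Definition stage w (k : nat) : word :=
  fun j => if (j < k)%N then base (cnt w k) j else w j.

Lemma lead_rseg w k c phi : (k < n)%N -> (2 * (cnt w k).+1 <= k.+1)%N -> w k = true ->
  lead n (stage w k.+1) c phi ->
  lead n (stage w k) c (rho (rseg (2 * cnt w k).+1 k) phi).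
Proof.
move=> hk ck wk hl; set a := (2 * cnt w k).+1.
(* The last 1 of the packed block, initially at a, is carried to p: p = a is the stage k + 1 and p =
   k is the stage k. Each generator of the segment moves it by one place. *)
pose mv p : word := fun j =>
  if (j <= k)%N then base (cnt w k) j || (j == p) else w j.
have mv_a : mv a = stage w k.+1.
  apply/funext => j; rewrite /mv /stage ltnS; case: ifP => // hj.
  rewrite /base /= wk addn1 /a.
  case: (eqVneq j (2 * cnt w k).+1) => [->|hja]; last by lia.
  by rewrite orbT; lia.
have mv_k : mv k = stage w k.
  apply/funext => j; rewrite /mv /stage; case: (ltngtP j k) => [hj|//|->].
    by rewrite orbF.
  by rewrite orbT wk.
have H p : (a <= p <= k)%N -> lead n (mv p) c (rho (rseg a p) phi).
  elim: p => [|p IH] hp; first by lia.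
  case: (eqVneq a p.+1) => [<-|hap].
    rewrite rseg_geq // mv_a; suff -> : rho 1 phi = phi by [].
    by apply/funext => v; apply: rho1.
  have -> : mv p.+1 = swap p (mv p).
    apply/funext => j; rewrite /swap.
    case: (eqVneq j p) => [->|h1].
      by rewrite /mv /base; case: ifP => //; case: ifP => //; lia.
    case: (eqVneq j p.+1) => [->|h2].
      by rewrite /mv eqxx !orbT; case: ifP; case: ifP => //; lia.
    by rewrite /mv (negPf h1) (negPf h2).
  rewrite rsegS; last by lia.
  rewrite rhoM rhog; last by lia.
  apply: lead_hop; [lia| | |apply: IH; lia].
    by rewrite /mv eqxx orbT; case: ifP => //; lia.
  rewrite /mv /base; case: ifP => //; lia.
by rewrite -mv_k; apply: H; lia.
Qed.

Lemma lead_vstar w c phi k : ballot n w -> (k <= n)%N -> lead n (stage w k) c phi ->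
  lead n w c (rho (vstar w k) phi).
Proof.
move=> bw; elim: k phi => [|k IH] phi hk /=.
  have -> : stage w 0 = w by apply/funext => j.
  by have -> : rho 1 phi = phi by apply/funext => v; apply: rho1.
have bk := bw _ hk; rewrite /= in bk.
move=> hl; case wk: (w k) bk => bk; last first.
  apply: IH; first by lia.
  have -> // : stage w k = stage w k.+1.
  apply/funext => j; rewrite /stage /= wk addn0 ltnS.
  case: (ltngtP j k) => // ->; rewrite wk /base; have := bw k (ltnW hk); lia.
rewrite rhoM; apply: IH; first by lia.
by apply: lead_rseg => //; lia.
Qed.

(** Each hop vanishes on equal letters, and the swaps of the other factors act on disjoint pairs. *)
Lemma rho_cups_pairs f phi w : (2 * f <= n)%N -> rho (cups g f) phi w <> 0 ->
  forall j, (j < f)%N -> w (2 * j).+1 = ~~ w (2 * j)%N.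
Proof.
suff H m : (2 * f <= n)%N -> (m <= f)%N ->
    rho (\prod_(f - m <= k < f) g (2 * k)) phi w <> 0 ->
    forall j, (f - m <= j < f)%N -> w (2 * j).+1 = ~~ w (2 * j)%N.
  by move=> hf hw j hj; apply: (H f); rewrite ?subnn.
move=> hf; elim: m w => [|m IH] w hm hw j hj; first by lia.
rewrite big_ltn in hw; last by lia.
have e : (f - m.+1).+1 = (f - m)%N by lia.
rewrite e rhoM rhog in hw; last by lia.
set i := (f - m.+1)%N in hw e hj *.
have hi : w (2 * i).+1 = ~~ w (2 * i)%N.
  case: (eqVneq (w (2 * i).+1) (w (2 * i)%N)) => [ei|]; first by rewrite hop0 in hw.
  by case: (w _); case: (w _).
case: (eqVneq j i) => [-> //|hji].
have hij : (f - m <= j < f)%N by lia.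
rewrite hopE // in hw.
set psi := rho _ _ in hw.
case: (eqVneq (psi w) 0) => [e1|/eqP h1]; last by apply: IH => //; lia.
case: (eqVneq (psi (swap (2 * i) w)) 0) => [e2|/eqP h2].
  by case: hw; rewrite e1 e2 mulr0 addr0.
have := IH _ (ltnW hm) h2 j hij; rewrite !swap_out //; lia.
Qed.

Lemma cnt_pairs f w : (forall j, (j < f)%N -> w (2 * j).+1 = ~~ w (2 * j)%N) ->
  forall j, (j <= f)%N -> cnt w (2 * j) = j.
Proof.
move=> h; elim=> [//|j IH] hj; rewrite mulnS /= IH ?h; [|lia..].
by case: (w _); lia.
Qed.

Lemma base_pairs f j : (j < f)%N -> base f (2 * j).+1 = ~~ base f (2 * j)%N.
Proof. by rewrite /base; lia. Qed.

(** A word in the support has exactly one 1 in each of the first f pairs. [base f] puts it second in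
    every pair and has no other 1, so its counts are the smallest. *)
Lemma lead_cups f phi : (2 * f <= n)%N ->
  lead n (base f) (rho (cups g f) phi (base f)) (rho (cups g f) phi).
Proof.
move=> hf; split=> // w /(rho_cups_pairs hf)/cnt_pairs hw k hk.
have hb := cnt_pairs (@base_pairs f).
case: (leqP (2 * f) k) => hfk.
  rewrite (@cnt_const (base f) (2 * f) k false) ?hb //; last by rewrite /base; lia.
  by have := cnt_mono w hfk; rewrite hw //; lia.
have [j hj] : exists2 j, (j < f)%N & k = (2 * j)%N \/ k = (2 * j).+1.
  by exists k./2; lia.
have cw : cnt w (2 * j) = j by apply: hw; lia.
have cb : cnt (base f) (2 * j) = j by apply: hb; lia.
have bj : base f (2 * j) = false by rewrite /base; lia.
by case=> ->; rewrite /= cw cb // bj; lia.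
Qed.

(** Each factor contributes its diagonal entry t at 01. The off-diagonal term alters a pair that the
    remaining factors never touch, and there the delta function kills it. *)
Lemma rho_cups_base f : (2 * f <= n)%N ->
  rho (cups g f) (delta (base f)) (base f) = t ^+ f.
Proof.
suff H m : (2 * f <= n)%N -> (m <= f)%N ->
    let psi := rho (\prod_(f - m <= k < f) g (2 * k)) (delta (base f)) in
    psi (base f) = t ^+ m /\
    forall w j, (j < 2 * (f - m))%N -> w j <> base f j -> psi w = 0.
  by move=> hf; have [] := H f hf (leqnn f); rewrite subnn.
move=> hf; elim: m => [|m IH] hm /=.
  rewrite subn0 big_geq // rho1 delta_id; split=> // w j hj hw.
  by rewrite rho1 delta_neq // => e; apply: hw; rewrite e.
have [IH1 IH2] := IH (ltnW hm).
rewrite big_ltn; last by lia.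
have e : (f - m.+1).+1 = (f - m)%N by lia.
rewrite e rhoM rhog; last by lia.
set psi := rho _ _ in IH1 IH2 *; set i := (f - m.+1)%N in e *.
have hb : base f (2 * i).+1 = ~~ base f (2 * i)%N by apply: base_pairs; lia.
have hb0 : base f (2 * i)%N = false by rewrite /base; lia.
split.
  rewrite hopE // IH1 hb0 /coef exprS (IH2 (swap (2 * i) (base f)) (2 * i)%N) ?addr0 //.
    by lia.
  by rewrite swap_l hb hb0.
move=> w j hj hw; rewrite /hop; case: ifP => // _.
rewrite (IH2 w j) ?mulr0 ?add0r //; last by lia.
apply: (IH2 _ j); first by lia.
by rewrite swap_out //; lia.
Qed.

Definition muv (u v : word) : A := vstar u n * cups g (cnt u n) * vword g v n.

Lemma star_muv u v : ballot n u -> cnt u n = cnt v n -> star (muv u v) = muv v u.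
Proof.
move=> bu cuv; rewrite /muv !starM star_vword // star_vstar // star_cups ?cuv ?mulrA //.
by have := bu n (leqnn n); rewrite cuv.
Qed.

Lemma stage_base w : (forall j, (n <= j)%N -> w j = false) -> ballot n w ->
  stage w n = base (cnt w n).
Proof.
move=> hw bw; apply/funext => j; rewrite /stage; case: ifP => // hj.
by rewrite hw ?/base; have := bw n (leqnn n); lia.
Qed.

Lemma lead_muv u v phi : ballot n u -> (forall j, (n <= j)%N -> u j = false) ->
  lead n u (rho (cups g (cnt u n) * vword g v n) phi (base (cnt u n)))
    (rho (muv u v) phi).
Proof.
move=> bu hu; rewrite /muv -mulrA rhoM rhoM; apply: lead_vstar => //.
by rewrite stage_base // rhoM; apply: lead_cups; apply: bu.
Qed.

(** The row side carries the entry to the base word; after transposition the column side is the same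
    argument with v in place of u. *)
Lemma muv_diag u v : ballot n u -> ballot n v -> cnt u n = cnt v n ->
  (forall j, (n <= j)%N -> u j = false) -> (forall j, (n <= j)%N -> v j = false) ->
  rho (muv u v) (delta v) u = t ^+ cnt u n.
Proof.
move=> bu bv cuv hu hv; have [-> _] := lead_muv v (delta v) bu hu.
have hf : (2 * cnt v n <= n)%N by apply: bv.
rewrite cuv rho_sym starM star_cups // star_vword // rhoM.
have hl : lead n (stage v n) (t ^+ cnt v n) (rho (cups g (cnt v n)) (delta (base (cnt v n)))).
  by rewrite stage_base // -rho_cups_base //; apply: lead_cups.
by have [] := lead_vstar bv (leqnn n) hl.
Qed.

Lemma word_cnt_inj u v : (forall k, (k <= n)%N -> cnt u k = cnt v k) ->
  (forall j, (n <= j)%N -> u j = false) -> (forall j, (n <= j)%N -> v j = false) ->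
  u = v.
Proof.
move=> h hu hv; apply/funext => j; case: (leqP n j) => hj; first by rewrite hu ?hv.
have := h j.+1 hj; have := h j (ltnW hj); rewrite /=.
by case: (u j); case: (v j); lia.
Qed.

Hypothesis alg_inj : forall c : R, c *: (1 : S) = 0 -> c = 0.

(** Among the indices with nonzero coefficient take i with the least sum of all counts of u_i and
    v_i, and read the entry (u_i, v_i). Any other contributing j has all its counts bounded by those
    of i, so minimality makes them equal and j = i. What is left is c_i times the unit t^f. *)
Lemma muv_free (I : finType) (u v : I -> word) (c : I -> R) :
  (forall i, ballot n (u i)) -> (forall i, ballot n (v i)) ->
  (forall i, cnt (u i) n = cnt (v i) n) ->
  (forall i j, (n <= j)%N -> u i j = false) ->
  (forall i j, (n <= j)%N -> v i j = false) ->
  (forall i j, u i = u j -> v i = v j -> i = j) ->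
  \sum_i c i *: muv (u i) (v i) = 0 -> forall i, c i = 0.
Proof.
move=> bu bv cuv hu hv uv_inj hsum i0; apply/eqP/negPn/negP => ci0.
pose M i := (\sum_(k < n.+1) (cnt (u i) k + cnt (v i) k))%N.
case: (@arg_minnP _ i0 (fun i => c i != 0) M ci0) => i ci imin {i0 ci0}.
have rho0 phi w : rho 0 phi w = 0 by rewrite -(scale0r 0) rhoZ scale0r.
have := congr1 (fun a => rho a (delta (v i)) (u i)) hsum.
rewrite rho0 (big_morph (fun a => rho a (delta (v i)) (u i)) (id1 := 0) (op1 := +%R)) //.
rewrite (bigD1 i) //= big1 => [|j hji].
  rewrite addr0 rhoZ (muv_diag (bu i) (bv i) (cuv i) (hu i) (hv i)) => h.
  move/eqP: ci; apply; apply: alg_inj.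
  have := congr1 (fun z => z * t' ^+ cnt (u i) n) h.
  rewrite mul0r -scalerAl -exprMn_comm; last by rewrite /GRing.comm tV t'V.
  by rewrite tV expr1n.
rewrite rhoZ; case: (eqVneq (c j) 0) => [->|cj]; first by rewrite scale0r.
case: (eqVneq (rho (muv (u j) (v j)) (delta (v i)) (u i)) 0) => [->|/eqP hE].
  by rewrite scaler0.
have [_ /(_ _ hE) le_u] := lead_muv (v j) (delta (v i)) (bu j) (hu j).
rewrite rho_sym star_muv // in hE.
have [_ /(_ _ hE) le_v] := lead_muv (u j) (delta (u i)) (bv j) (hv j).
have le_k (k : 'I_n.+1) :
    (cnt (u j) k + cnt (v j) k <= cnt (u i) k + cnt (v i) k ?=
       iff (cnt (u j) k + cnt (v j) k == cnt (u i) k + cnt (v i) k))%N.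
  by apply: leqif_eq; rewrite leq_add ?le_u ?le_v // -ltnS.
have [le_M eq_M] := leqif_sum (fun k (_ : predT k) => le_k k).
have : M j == M i by rewrite eqn_leq le_M (imin _ cj).
rewrite /M eq_M => /forallP /= all_eq.
have both k : (k <= n)%N -> cnt (u j) k = cnt (u i) k /\ cnt (v j) k = cnt (v i) k.
  move=> hk; have := all_eq (Ordinal (hk : (k < n.+1)%N)) => /= /eqP.
  by have := le_u k hk; have := le_v k hk; lia.
case/eqP: hji; apply: uv_inj; apply: word_cnt_inj; try by [apply: hu|apply: hv].
  by move=> k /both[].
by move=> k /both[].
Qed.

End Independence.

(** * Linear maps on the free algebra, and induction principles for it and for its quotient *)

Section LinearExtension.
Variables (R : comNzRingType) (K : choiceType) (A : lalgType R) (h : K -> A).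

(* Locked, so that unification does not unfold it. *)
Fact lin_ext_key : unit. Proof. by []. Qed.
Definition lin_ext : {malg R[K]} -> A :=
  locked_with lin_ext_key (mmap (in_alg A) h).

Lemma lin_extE a : lin_ext a = mmap (in_alg A) h a.
Proof. by rewrite /lin_ext unlock. Qed.

Lemma lin_ext_is_linear : linear lin_ext.
Proof.
move=> c a b; rewrite !lin_extE mmapD; congr (_ + _).
rewrite (mmapEw (msuppZ_le _ _)) mmapE scaler_sumr; apply: eq_bigr => k _.
by rewrite mcoeffZ /= -scalerA -!scalerAl.
Qed.

HB.instance Definition _ := GRing.isLinear.Build R {malg R[K]} A *:%R lin_ext
  lin_ext_is_linear.

Lemma lin_extU k : lin_ext << k >> = h k.
Proof. by rewrite lin_extE mmapU /= scale1r mul1r. Qed.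

End LinearExtension.

Section FreeLetters.
Variable n : nat.

Lemma TLletterE (j : 'I_n.-1) : TLletter n j.+1 = << fmu j >>.
Proof. by rewrite /TLletter valK. Qed.

Lemma ltn_letter i : (0 < i < n)%N -> exists j : 'I_n.-1, i = j.+1.
Proof.
case: i => // i hi; have hj : (i < n.-1)%N by lia.
by exists (Ordinal hj).
Qed.

Lemma letter_ltn (j : 'I_n.-1) : (0 < j.+1 < n)%N.
Proof. by have := ltn_ord j; lia. Qed.

Lemma TLfree_lin_ind (P : TLfree n -> Prop) :
  P 0 -> (forall a b, P a -> P b -> P (a + b)) ->
  (forall c a, P a -> P (c *: a)) ->
  (forall k, P << k >>) -> forall a, P a.
Proof.
move=> P0 PD PZ Pk a; rewrite [a]monalgE; apply: big_ind => // k _.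
have -> : << a@_k *g k >> = a@_k *: << k >>.
  by apply/malgP => k'; rewrite mcoeffZ !mcoeffU mulr_natr.
exact: PZ.
Qed.

Lemma TLletter_monom (j : 'I_n.-1) (k : {fmonom 'I_n.-1}) :
  TLletter n j.+1 * << k >> = << FMonom (j :: k) >>.
Proof.
rewrite TLletterE malgM_def fgmulUU mulr1; congr << _ >>.
by apply/eqP; rewrite fmP fmM fmU.
Qed.

Lemma TLfree_ind (P : TLfree n -> Prop) :
  P 1 -> (forall a b, P a -> P b -> P (a + b)) ->
  (forall c a, P a -> P (c *: a)) ->
  (forall i a, (0 < i < n)%N -> P a -> P (TLletter n i * a)) ->
  forall a, P a.
Proof.
move=> P1 PD PZ PM; apply: TLfree_lin_ind => //.
  by rewrite -(scale0r 1); apply: PZ.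
case=> s; elim: s => [|j s IH].
  suff -> : FMonom [::] = mone :> {fmonom 'I_n.-1} by [].
  by apply/eqP; rewrite fmP fm1.
rewrite -[s]/(fmonom_val (FMonom s)) -TLletter_monom.
exact: PM (letter_ltn j) IH.
Qed.

End FreeLetters.

Section Presentation.
Variable n : nat.
Implicit Types (a b : TLfree n) (u v : TL n).

Lemma TLpi_mul a b : TLpi (a * b) = TLpi a * TLpi b.
Proof. by rewrite -TLpiM. Qed.

Lemma TLpi_scale c a : TLpi (c *: a) = c *: TLpi a.
Proof. by rewrite -TLpiZ. Qed.

Lemma TLpi_rel a b : TLrel (a - b) -> TLpi a = TLpi b.
Proof.
move=> h; apply/TLpi_eq/TLidealP; exists [:: (1, a - b, 1)].
  by move=> t; rewrite inE => /eqP ->.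
by rewrite big_seq1 mul1r mulr1.
Qed.

Lemma TLgen_sqr i : (0 < i < n)%N -> TLgen n i * TLgen n i = 'X *: TLgen n i.
Proof. by move=> hi; have := TLpi_rel (TLrel_sqr hi); rewrite TLpi_mul TLpi_scale. Qed.

Lemma TLgen_braid i j : (0 < i < n)%N -> (0 < j < n)%N ->
  (j == i.+1) || (i == j.+1) -> TLgen n i * TLgen n j * TLgen n i = TLgen n i.
Proof.
move=> hi hj hij.
have mul3 a b c : TLpi (a * b * c) = TLpi a * TLpi b * TLpi c by rewrite !TLpi_mul.
exact: etrans (esym (mul3 _ _ _)) (TLpi_rel (TLrel_braid hi hj hij)).
Qed.

Lemma TLgen_comm i j : (0 < i < n)%N -> (0 < j < n)%N ->
  (i + 2 <= j)%N || (j + 2 <= i)%N -> GRing.comm (TLgen n i) (TLgen n j).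
Proof.
move=> hi hj hij; have e := TLpi_rel (TLrel_comm hi hj hij).
exact: etrans (esym (TLpi_mul _ _)) (etrans e (TLpi_mul _ _)).
Qed.

Lemma TL_ind (P : TL n -> Prop) :
  P 1 -> (forall u v, P u -> P v -> P (u + v)) ->
  (forall c u, P u -> P (c *: u)) ->
  (forall i u, (0 < i < n)%N -> P u -> P (TLgen n i * u)) ->
  forall u, P u.
Proof.
move=> P1 PD PZ PM u; rewrite -[u]TLpi_repr; move: (repr u).
apply: TLfree_ind => [|a b|c a|i a hi] //.
- by rewrite TLpiD; apply: PD.
- by rewrite TLpi_scale; apply: PZ.
- by rewrite TLpi_mul; apply: PM.
Qed.

End Presentation.

(** * Compatibility of reversal and of the spin-chain action with the relations *)

Section LetterMorphism.
Variables (n : nat) (F : lalgType {poly int}) (L : nat -> F).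
Hypothesis F_ind : forall P : F -> Prop,
  P 1 -> (forall a b, P a -> P b -> P (a + b)) ->
  (forall c a, P a -> P (c *: a)) ->
  (forall i a, (0 < i < n)%N -> P a -> P (L i * a)) -> forall a, P a.

Section Reversal.
Variables (B : algType {poly int}) (g : nat -> B) (f : F -> B).
Hypothesis g_sqr : forall i, (0 < i < n)%N -> g i * g i = 'X *: g i.
Hypothesis g_braid : forall i j, (0 < i < n)%N -> (0 < j < n)%N ->
  (j == i.+1) || (i == j.+1) -> g i * g j * g i = g i.
Hypothesis g_comm : forall i j, (0 < i < n)%N -> (0 < j < n)%N ->
  (i + 2 <= j)%N || (j + 2 <= i)%N -> GRing.comm (g i) (g j).
Hypothesis fD : forall a b, f (a + b) = f a + f b.
Hypothesis fZ : forall c a, f (c *: a) = c *: f a.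
Hypothesis f1 : f 1 = 1.
Hypothesis fL : forall i a, (0 < i < n)%N -> f (L i * a) = f a * g i.

(** Knowing the effect of one letter on the left is enough: induction on the left factor gives the
    rest. [act_mul] follows the same pattern. *)
Lemma rev_mul a b : f (a * b) = f b * f a.
Proof.
move: a; apply: F_ind => [|a a' IHa IHa'|c a IH|i a hi IH].
- by rewrite mul1r f1 mulr1.
- by rewrite mulrDl !fD mulrDr IHa IHa'.
- by rewrite -scalerAl !fZ IH scalerAr.
- by rewrite -mulrA !fL // IH mulrA.
Qed.

Lemma rev_letter i : (0 < i < n)%N -> f (L i) = g i.
Proof. by move=> hi; rewrite -[L i]mulr1 fL // f1 mul1r. Qed.

Lemma rev_sub a b : f (a - b) = f a - f b.
Proof. by rewrite -scaleN1r fD fZ scaleN1r. Qed.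

Lemma rev_ideal (P : F -> Prop) a :
  (forall r, P r -> f r = 0) -> ideal_gen P a -> f a = 0.
Proof.
move=> hP [s hs ->]; elim: s hs => [|r s IH] hs.
  by rewrite big_nil -(scale0r 0) fZ scale0r.
rewrite big_cons fD IH => [|q hq]; last by apply: hs; rewrite inE hq orbT.
by rewrite !rev_mul (hP r.1.2) ?mul0r ?mulr0 ?addr0 //; apply: hs; rewrite inE eqxx.
Qed.

Lemma rev_sqr i : (0 < i < n)%N -> f (L i ^+ 2 - 'X *: L i) = 0.
Proof. by move=> hi; rewrite rev_sub fZ rev_mul rev_letter // g_sqr // subrr. Qed.

Lemma rev_braid i j : (0 < i < n)%N -> (0 < j < n)%N ->
  (j == i.+1) || (i == j.+1) -> f (L i * L j * L i - L i) = 0.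
Proof.
by move=> hi hj hij; rewrite rev_sub !rev_mul !rev_letter // mulrA g_braid // subrr.
Qed.

Lemma rev_comm i j : (0 < i < n)%N -> (0 < j < n)%N ->
  (i + 2 <= j)%N || (j + 2 <= i)%N -> f (L i * L j - L j * L i) = 0.
Proof.
by move=> hi hj hij; rewrite rev_sub !rev_mul !rev_letter // (g_comm hi hj hij) subrr.
Qed.

End Reversal.

Section Action.
Variables (S : algType {poly int}) (t t' : S) (f : F -> (word -> S) -> word -> S).
Hypothesis tV : t * t' = 1.
Hypothesis t'V : t' * t = 1.
Hypothesis tD : t + t' = 'X%:A.
Local Notation hop := (hop t t').
Hypothesis fD : forall a b phi w, f (a + b) phi w = f a phi w + f b phi w.
Hypothesis fZ : forall c a phi w, f (c *: a) phi w = c *: f a phi w.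
Hypothesis f1 : forall phi, f 1 phi = phi.
Hypothesis fL : forall i a phi, (0 < i < n)%N -> f (L i * a) phi = hop i.-1 (f a phi).

Lemma act_mul a b phi : f (a * b) phi = f a (f b phi).
Proof.
move: a; apply: F_ind => [|a a' IHa IHa'|c a IH|i a hi IH].
- by rewrite mul1r f1.
- by rewrite mulrDl; apply/funext => w; rewrite !fD IHa IHa'.
- by rewrite -scalerAl; apply/funext => w; rewrite !fZ IH.
- by rewrite -mulrA !fL // IH.
Qed.

Lemma act_letter i phi : (0 < i < n)%N -> f (L i) phi = hop i.-1 phi.
Proof. by move=> hi; rewrite -[L i]mulr1 fL // f1. Qed.

Lemma act_sub a b phi w : f (a - b) phi w = f a phi w - f b phi w.
Proof. by rewrite -scaleN1r fD fZ scaleN1r. Qed.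

Lemma act_0r a w : f a (fun=> 0) w = 0.
Proof.
move: a w; apply: F_ind => [|a a' IHa IHa'|c a IH|i a hi IH] w.
- by rewrite f1.
- by rewrite fD IHa IHa' addr0.
- by rewrite fZ IH scaler0.
- by rewrite fL // /hop !IH mulr0 addr0; case: ifP.
Qed.

Lemma act_ideal (P : F -> Prop) a phi w :
  (forall r psi v, P r -> f r psi v = 0) -> ideal_gen P a -> f a phi w = 0.
Proof.
move=> hP [s hs ->]; elim: s hs => [|r s IH] hs.
  by rewrite big_nil -(scale0r 0) fZ scale0r.
rewrite big_cons fD IH => [|q hq]; last by apply: hs; rewrite inE hq orbT.
rewrite addr0 !act_mul; suff -> : f r.1.2 (f r.2 phi) = fun=> 0 by apply: act_0r.
by apply/funext => v; apply/hP/hs; rewrite inE eqxx.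
Qed.

Lemma act_sqr i phi w : (0 < i < n)%N -> f (L i ^+ 2 - 'X *: L i) phi w = 0.
Proof.
by move=> hi; rewrite act_sub fZ act_mul !act_letter // (hop_sqr tV t'V tD) subrr.
Qed.

Lemma act_braid i j phi w : (0 < i < n)%N -> (0 < j < n)%N ->
  (j == i.+1) || (i == j.+1) -> f (L i * L j * L i - L i) phi w = 0.
Proof.
move=> hi hj hij; rewrite act_sub !act_mul !act_letter //.
case: i hi hij => // i hi; case: j hj => // j hj /=.
case/orP=> /eqP [->]; first by rewrite (hop_braidl tV t'V) subrr.
by rewrite (hop_braidr tV t'V) subrr.
Qed.

Lemma act_comm i j phi w : (0 < i < n)%N -> (0 < j < n)%N ->
  (i + 2 <= j)%N || (j + 2 <= i)%N -> f (L i * L j - L j * L i) phi w = 0.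
Proof.
move=> hi hj hij; rewrite act_sub !act_mul !act_letter //; case/orP: hij => hij.
  by rewrite (hop_comm tV t'V) ?subrr //; lia.
by rewrite [X in _ - X](hop_comm tV t'V) ?subrr //; lia.
Qed.

End Action.
End LetterMorphism.


(** * Reversal and the spin-chain action defined on monomials *)

Section FreeMaps.
Variable n : nat.

Lemma TLfree_lin_eq (V : lmodType {poly int}) (p q : TLfree n -> V) :
  linear p -> linear q -> (forall k, p << k >> = q << k >>) -> p =1 q.
Proof.
move=> lp lq hpq.
have lin0 (r : TLfree n -> V) : linear r -> r 0 = 0.
  by move=> lr; apply: (addrI (r 0)); rewrite -[X in X + _]scale1r -lr scale1r !addr0.
have linD (r : TLfree n -> V) : linear r -> forall a b, r (a + b) = r a + r b.
  by move=> lr a b; have := lr 1 a b; rewrite !scale1r.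
have linZ (r : TLfree n -> V) : linear r -> forall c a, r (c *: a) = c *: r a.
  by move=> lr c a; have := lr c a 0; rewrite lin0 // !addr0.
apply: TLfree_lin_ind => [|a b ea eb|c a ea|//].
- by rewrite !lin0.
- exact: etrans (linD p lp a b) (etrans (f_equal2 +%R ea eb) (esym (linD q lq a b))).
- exact: etrans (linZ p lp c a) (etrans (congr1 ( *:%R c) ea) (esym (linZ q lq c a))).
Qed.

Lemma TLfree_mul_linear (l : TLfree n) : linear (fun a => l * a).
Proof.
have lZ c (a : TLfree n) : l * (c *: a) = c *: (l * a) by exact/esym/fmalg_scalerAr.
move=> c a b; exact: etrans (mulrDr l (c *: a) b) (congr1 (fun z => z + l * b) (lZ c a)).
Qed.

Section RevFree.
Variables (B : algType {poly int}) (g : nat -> B).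

Definition rev_free : TLfree n -> B :=
  lin_ext (fun k : {fmonom 'I_n.-1} => foldr (fun (j : 'I_n.-1) b => b * g j.+1) 1 k).

Lemma rev_free_linear : linear rev_free.
Proof. exact: linearP. Qed.

Lemma rev_freeD a b : rev_free (a + b) = rev_free a + rev_free b.
Proof. exact: linearD. Qed.

Lemma rev_freeZ c a : rev_free (c *: a) = c *: rev_free a.
Proof. exact: linearZ. Qed.

Lemma rev_free1 : rev_free 1 = 1.
Proof. by apply: etrans (lin_extU _ mone) _; rewrite fm1. Qed.

Lemma rev_free_letter i a : (0 < i < n)%N ->
  rev_free (TLletter n i * a) = rev_free a * g i.
Proof.
move=> hi; have [j ->] := ltn_letter hi; move: a.
apply: TLfree_lin_eq => [c a b|c a b|k].
- exact: etrans (congr1 rev_free (TLfree_mul_linear _ c a b)) (rev_free_linear _ _ _).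
- rewrite rev_free_linear; move: (rev_free a) (rev_free b) => u v.
  by rewrite mulrDl -scalerAl.
- by rewrite TLletter_monom /rev_free !lin_extU.
Qed.

End RevFree.

Section ActFree.
Variables (S : algType {poly int}) (t t' : S).
Local Notation hop := (hop t t').

Definition act_free (a : TLfree n) (phi : word -> S) : word -> S := fun w =>
  lin_ext (fun k : {fmonom 'I_n.-1} => foldr (fun j : 'I_n.-1 => hop j) phi k w) a.

Lemma act_free_linear c a b phi w :
  act_free (c *: a + b) phi w = c *: act_free a phi w + act_free b phi w.
Proof. exact: linearP. Qed.

Lemma act_freeD a b phi w : act_free (a + b) phi w = act_free a phi w + act_free b phi w.
Proof. exact: linearD. Qed.

Lemma act_freeZ c a phi w : act_free (c *: a) phi w = c *: act_free a phi w.
Proof. exact: linearZ. Qed.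

Lemma act_free1 phi : act_free 1 phi = phi.
Proof. by apply/funext => w; apply: etrans (lin_extU _ mone) _; rewrite fm1. Qed.

Lemma hop_linear i c (phi psi : word -> S) w :
  hop i (fun w => c *: phi w + psi w) w = c *: hop i phi w + hop i psi w.
Proof.
rewrite /hop; case: ifP => _; first by rewrite scaler0 addr0.
by rewrite mulrDr -scalerAr addrACA -scalerDr.
Qed.

Lemma act_free_letter i a phi : (0 < i < n)%N ->
  act_free (TLletter n i * a) phi = hop i.-1 (act_free a phi).
Proof.
move=> hi; have [j ->] := ltn_letter hi; apply/funext => w; move: a.
apply: TLfree_lin_eq => [c a b|c a b|k].
- exact: etrans (congr1 (fun z => act_free z phi w) (TLfree_mul_linear _ c a b))
    (act_free_linear _ _ _ _ _).
- rewrite -hop_linear; congr (hop _ _ w); apply/funext => v.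
  exact: act_free_linear.
- rewrite TLletter_monom /act_free lin_extU [LHS]/=; congr (hop _ _ w).
  by apply/funext => v; rewrite lin_extU.
Qed.

End ActFree.
End FreeMaps.

(** The matrix t is the companion matrix of T^2 - xT + 1 and t' is its adjugate. Working in 2 by 2
    matrices replaces the quadratic extension: the identities are checked entrywise and faithfulness
    of the scalars is read off a diagonal entry. *)
Lemma companion_pair : exists (S : algType {poly int}) (t t' : S),
  [/\ t * t' = 1, t' * t = 1, t + t' = 'X%:A &
      forall c : {poly int}, c *: (1 : S) = 0 -> c = 0].
Proof.
pose mx (a b c d : {poly int}) : 'M[{poly int}]_2 :=
  \matrix_(i, j) (if i == 0 then if j == 0 then a else b else if j == 0 then c else d).
exists 'M[{poly int}]_2, (mx 0 (-1) 1 'X), (mx 'X 1 (-1) 0).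
have ord2P (P : 'I_2 -> Prop) : P 0 -> P 1 -> forall i, P i.
  move=> P0 P1 i; case: (eqVneq i 0) => [-> //|hi].
  by have -> : i = 1 by apply: val_inj; case: i hi => [[|[]]].
split=> [| | |c /matrixP/(_ 0 0)].
- by apply/matrixP; do 2 apply: (ord2P _); rewrite !mxE !big_ord_recl big_ord0 !mxE /=; ring.
- by apply/matrixP; do 2 apply: (ord2P _); rewrite !mxE !big_ord_recl big_ord0 !mxE /=; ring.
- by apply/matrixP; do 2 apply: (ord2P _); rewrite !mxE /=; ring.
- by rewrite !mxE mulr1.
Qed.

(** * Descent to the quotient: the anti-involution and the representation *)

Section Descent.
Variable n : nat.

(** The chosen representative differs from a by an element of the ideal, so composing f with [repr]
    gives the induced map on the quotient. *)
Lemma TLrepr_pi (V : lmodType {poly int}) (f : TLfree n -> V) : linear f ->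
  (forall a, ideal_gen (@TLrel n) a -> f a = 0) -> forall a, f (repr (TLpi a)) = f a.
Proof.
move=> lf f0 a.
have /TLidealP/f0 : repr (TLpi a) - a \in @TLideal n by apply/TLpi_eq; rewrite TLpi_repr.
move: (repr (TLpi a)) => b hb.
have := lf 1 (b - a) a; rewrite scale1r subrK hb => ->.
by rewrite scaler0 add0r.
Qed.

Lemma TLrepr_linear (V : lmodType {poly int}) (f : TLfree n -> V) : linear f ->
  (forall a, ideal_gen (@TLrel n) a -> f a = 0) ->
  linear (fun u : TL n => f (repr u)).
Proof.
move=> lf f0 c u v; rewrite -{1}[u]TLpi_repr -{1}[v]TLpi_repr.
rewrite -TLpi_scale -TLpiD TLrepr_pi //; exact: lf.
Qed.

Local Notation rf := (@rev_free n (TL n) (TLgen n)).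
Let rfD := @rev_freeD n (TL n) (TLgen n).
Let rfZ := @rev_freeZ n (TL n) (TLgen n).
Let rf1 := @rev_free1 n (TL n) (TLgen n).
Let rfL := @rev_free_letter n (TL n) (TLgen n).

Definition TLstar (u : TL n) : TL n := rf (repr u).

Lemma TLstar_ideal a : ideal_gen (@TLrel n) a -> rf a = 0.
Proof.
apply: (rev_ideal (@TLfree_ind n) rfD rfZ rf1 rfL) => _ [].
- exact: (rev_sqr (@TLfree_ind n) (@TLgen_sqr n) rfD rfZ rf1 rfL).
- exact: (rev_braid (@TLfree_ind n) (@TLgen_braid n) rfD rfZ rf1 rfL).
- exact: (rev_comm (@TLfree_ind n) (@TLgen_comm n) rfD rfZ rf1 rfL).
Qed.

Lemma TLstar_pi a : TLstar (TLpi a) = rf a.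
Proof. exact: (TLrepr_pi (rev_free_linear _) TLstar_ideal). Qed.

Lemma TLstar_linear : linear TLstar.
Proof. exact: (TLrepr_linear (rev_free_linear _) TLstar_ideal). Qed.

HB.instance Definition _ := GRing.isLinear.Build {poly int} (TL n) (TL n) *:%R TLstar
  TLstar_linear.

Lemma TLstar1 : TLstar 1 = 1.
Proof. exact: etrans (TLstar_pi 1) rf1. Qed.

Lemma TLstarM u v : TLstar (u * v) = TLstar v * TLstar u.
Proof.
exact: etrans (TLstar_pi _) (rev_mul (@TLfree_ind n) rfD rfZ rf1 rfL _ _).
Qed.

Lemma TLstar_gen i : (0 < i < n)%N -> TLstar (TLgen n i) = TLgen n i.
Proof. by move=> hi; exact: etrans (TLstar_pi _) (rev_letter rf1 rfL hi). Qed.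

Section HopRep.
Variables (S : algType {poly int}) (t t' : S).
Hypothesis tV : t * t' = 1.
Hypothesis t'V : t' * t = 1.
Hypothesis tD : t + t' = 'X%:A.

Definition TLact (u : TL n) (phi : word -> S) : word -> S :=
  act_free t t' (repr u) phi.

Local Notation af := (@act_free n S t t').

Let afD := @act_freeD n S t t'.
Let afZ := @act_freeZ n S t t'.
Let af1 := @act_free1 n S t t'.
Let afL := @act_free_letter n S t t'.

Lemma TLact_ideal phi w a : ideal_gen (@TLrel n) a -> af a phi w = 0.
Proof.
apply: (act_ideal (@TLfree_ind n) afD afZ af1 afL) => _ psi v [].
- move=> i; exact: (act_sqr (@TLfree_ind n) tV t'V tD afD afZ af1 afL).
- move=> i j; exact: (act_braid (@TLfree_ind n) tV t'V afD afZ af1 afL).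
- move=> i j; exact: (act_comm (@TLfree_ind n) tV t'V afD afZ af1 afL).
Qed.

Lemma TLact_pi a phi : TLact (TLpi a) phi = af a phi.
Proof.
apply/funext => w.
exact: (TLrepr_pi (fun c b d => act_free_linear t t' c b d phi w) (@TLact_ideal phi w)).
Qed.

Lemma TLact_linear phi w : linear (fun u => TLact u phi w).
Proof.
exact: (TLrepr_linear (fun c b d => act_free_linear t t' c b d phi w) (@TLact_ideal phi w)).
Qed.

Lemma TLactZ c u phi w : TLact (c *: u) phi w = c *: TLact u phi w.
Proof.
have h0 := TLact_linear phi w 1 0 0; rewrite !scale1r addr0 in h0.
have {}h0 : TLact 0 phi w = 0 by apply: (addrI (TLact 0 phi w)); rewrite -h0 addr0.
by have := TLact_linear phi w c u 0; rewrite h0 !addr0.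
Qed.

Lemma TLactD u v phi w : TLact (u + v) phi w = TLact u phi w + TLact v phi w.
Proof. by have := TLact_linear phi w 1 u v; rewrite !scale1r. Qed.

Lemma TLact1 phi w : TLact 1 phi w = phi w.
Proof. by rewrite -[1]/(TLpi 1) TLact_pi act_free1. Qed.

Lemma TLactM u v phi : TLact (u * v) phi = TLact u (TLact v phi).
Proof.
exact: etrans (TLact_pi _ _) (act_mul (@TLfree_ind n) afD afZ af1 afL _ _ _).
Qed.

Lemma TLact_gen i phi : (0 < i < n)%N -> TLact (TLgen n i) phi = hop t t' i.-1 phi.
Proof.
move=> hi; exact: etrans (TLact_pi _ _) (act_letter af1 afL _ hi).
Qed.

End HopRep.
End Descent.

(** * Spanning by the m_uv *)

Section Spanning.
Variables (R : comNzRingType) (x : R) (A : algType R) (n : nat) (g : nat -> A).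
Hypothesis g_sqr : forall i, (i.+1 < n)%N -> g i * g i = x *: g i.
Hypothesis g_braid : forall i j, (i.+1 < n)%N -> (j.+1 < n)%N ->
  (j == i.+1) || (i == j.+1) -> g i * g j * g i = g i.
Hypothesis g_comm : forall i j, (i.+1 < n)%N -> (j.+1 < n)%N ->
  (i.+1 < j)%N || (j.+1 < i)%N -> GRing.comm (g i) (g j).
Hypothesis A_ind : forall P : A -> Prop,
  P 1 -> (forall a b, P a -> P b -> P (a + b)) ->
  (forall c a, P a -> P (c *: a)) ->
  (forall i a, (i.+1 < n)%N -> P a -> P (g i * a)) -> forall a, P a.

Lemma cell_span_mul (J : A -> Prop) f a b :
  (forall a b c, J b -> J (a * b * c)) ->
  ((2 * f.+1 <= n)%N -> J (cups g f.+1)) ->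
  (exists d, cell_span n g J f d a) -> exists d, cell_span n g J f d (a * b).
Proof.
move=> Jmul Jcups; move: b a; apply: A_ind => [|b c IHb IHc|k b IH|i b hi IH] a ha.
- by rewrite mulr1.
- have [[d1 h1] [d2 h2]] := (IHb a ha, IHc a ha).
  exists (maxn d1 d2); rewrite mulrDr; apply: Span_add.
    by apply: cell_span_le h1; apply: leq_maxl.
  by apply: cell_span_le h2; apply: leq_maxr.
- by have [d h] := IH a ha; exists d; rewrite -scalerAr; apply: Span_scale.
rewrite mulrA; apply: IH; case: ha => d hd; exists d.+1.
apply: cell_span_mulr hd => // w bw cw _.
exact: (yword_mul g_sqr g_braid g_comm).
Qed.

Lemma muv_yword u v : ballot n v -> cnt u n = cnt v n ->
  muv n g u v = vstar g u n * yword g v n.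
Proof. by move=> bv cuv; rewrite /muv cuv -(cups_vword g_comm) // mulrA. Qed.

Lemma ballot_base f : (2 * f <= n)%N -> ballot n (base f).
Proof.
move=> hf k hk; have hb := cnt_pairs (@base_pairs f).
case: (leqP (2 * f) k) => hfk.
  rewrite (@cnt_const (base f) (2 * f) k false) ?hb //; last by rewrite /base; lia.
  by lia.
have [j hj] : exists2 j, (j < f)%N & k = (2 * j)%N \/ k = (2 * j).+1.
  by exists k./2; lia.
have cb : cnt (base f) (2 * j) = j by apply: hb; lia.
have bj : base f (2 * j) = false by rewrite /base; lia.
by case=> ->; rewrite /= cb // bj; lia.
Qed.

Lemma cnt_base f : (2 * f <= n)%N -> cnt (base f) n = f.
Proof.
move=> hf; rewrite (@cnt_const (base f) (2 * f) n false) //; last by rewrite /base; lia.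
by rewrite (cnt_pairs (@base_pairs f)) //; lia.
Qed.

Lemma cnt_base_lt f j : (j < f)%N -> cnt (base f) (2 * j).+1 = j.
Proof.
by move=> hj; rewrite /= (cnt_pairs (@base_pairs f)) /base; lia.
Qed.

Lemma vword_base f k : vword g (base f) k = 1.
Proof.
elim: k => //= k ->; case: ifP => //; rewrite /base => /andP[ok hk].
rewrite (_ : k = (2 * k./2).+1); last by lia.
by rewrite cnt_base_lt ?mulr1 /seg ?big_geq //; lia.
Qed.

Lemma vstar_base f k : vstar g (base f) k = 1.
Proof.
elim: k => //= k ->; case: ifP => //; rewrite /base => /andP[ok hk].
rewrite (_ : k = (2 * k./2).+1); last by lia.
by rewrite cnt_base_lt ?mul1r ?rseg_geq //; lia.
Qed.

Lemma muv_base f : (2 * f <= n)%N -> muv n g (base f) (base f) = cups g f.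
Proof. by move=> hf; rewrite /muv vstar_base vword_base cnt_base // mul1r mulr1. Qed.

Inductive muv_span (f : nat) : A -> Prop :=
| Mspan_muv u v : ballot n u -> ballot n v -> cnt u n = cnt v n ->
    (f <= cnt u n)%N -> muv_span f (muv n g u v)
| Mspan_add a b : muv_span f a -> muv_span f b -> muv_span f (a + b)
| Mspan_scale c a : muv_span f a -> muv_span f (c *: a)
| Mspan_zero : muv_span f 0.

Lemma muv_span_le f f' a : (f' <= f)%N -> muv_span f a -> muv_span f' a.
Proof.
move=> hf; elim=> {a} [u v bu bv cuv fu|a b _ ha _ hb|c a _ ha|].
- by apply: Mspan_muv => //; apply: leq_trans fu.
- exact: Mspan_add.
- exact: Mspan_scale.
- exact: Mspan_zero.
Qed.

Variable star : A -> A.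
Hypothesis star1 : star 1 = 1.
Hypothesis starD : forall a b, star (a + b) = star a + star b.
Hypothesis starZ : forall c a, star (c *: a) = c *: star a.
Hypothesis starM : forall a b, star (a * b) = star b * star a.
Hypothesis starg : forall i, (i.+1 < n)%N -> star (g i) = g i.

Lemma muv_span_star f a : muv_span f a -> muv_span f (star a).
Proof.
elim=> {a} [u v bu bv cuv fu|a b _ ha _ hb|c a _ ha|].
- rewrite (star_muv A_ind star1 starD starZ starM starg g_comm) //.
  by apply: Mspan_muv; rewrite -?cuv.
- by rewrite starD; apply: Mspan_add.
- by rewrite starZ; apply: Mspan_scale.
- by rewrite -(scale0r 0) starZ scale0r; apply: Mspan_zero.
Qed.

(** All f' from f on are generators, so every m_uv with at least f cups lies in it without comparing
    different products of cups. *)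
Definition cups_ideal (f : nat) : A -> Prop :=
  ideal_gen (fun m => exists f', [/\ (f <= f')%N, (2 * f' <= n)%N & m = cups g f']).

Lemma cups_ideal_cups f f' : (f <= f')%N -> (2 * f' <= n)%N -> cups_ideal f (cups g f').
Proof.
move=> hf hn; exists [:: (1, cups g f', 1)]; last by rewrite big_seq1 mul1r mulr1.
by move=> r; rewrite inE => /eqP -> /=; exists f'.
Qed.

(** The span is stable under right multiplication: v_u^* stays in front while [cell_span_mul]
    expands the rest modulo more cups, where induction applies. Conjugating by [star] gives left
    multiplication, and each generator of the ideal is the m_uu of a base word. *)
Lemma cups_ideal_span f a : cups_ideal f a -> muv_span f a.
Proof.
have [m] := ubnP (n.+1 - f)%N; elim: m f a => // m IH f a hm.
case: (leqP f n) => hfn; last first.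
  case=> -[|r s] hs ->; first by rewrite big_nil; apply: Mspan_zero.
  by have [|f' []] := hs r; [rewrite inE eqxx|lia].
have Q b : cups_ideal f.+1 b -> muv_span f b.
  by move=> hb; apply: (@muv_span_le f.+1) => //; apply: IH => //; lia.
have span_mulr b : muv_span f b -> forall c, muv_span f (b * c).
  elim=> {b} [u v bu bv cuv|b b' _ hb _ hb'|k b _ hb|] => [fu c|c|c|c].
  - move: fu; rewrite leq_eqVlt => /orP[/eqP ef|fu]; last first.
      apply: Q; rewrite /muv -mulrA; apply: ideal_gen_mul.
      apply: cups_ideal_cups => //; exact: bu.
    rewrite muv_yword // -mulrA.
    have [d] : exists d, cell_span n g (cups_ideal f.+1) f d (yword g v n * c).
      apply: cell_span_mul; [by move=> *; apply: ideal_gen_mul|exact: cups_ideal_cups|].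
      by exists (defect n v); apply: Span_word; rewrite -?cuv.
    elim=> {c} [w bw cw _|b hb|b b' _ hb _ hb'|k b _ hb].
    - by rewrite -muv_yword ?cw //; apply: Mspan_muv; rewrite ?cw // -ef.
    - by apply: Q; rewrite -[_ * b]mulr1; apply: ideal_gen_mul.
    - by rewrite mulrDr; apply: Mspan_add.
    - by rewrite -scalerAr; apply: Mspan_scale.
  - by rewrite mulrDl; apply: Mspan_add.
  - by rewrite -scalerAl; apply: Mspan_scale.
  - by rewrite mul0r; apply: Mspan_zero.
have span_mull b c : muv_span f b -> muv_span f (c * b).
  move=> /muv_span_star/span_mulr/(_ (star c)) /muv_span_star.
  by rewrite starM !(starK A_ind star1 starD starZ starM starg).
case=> s hs ->; elim: s hs => [|r s IHs] hs; first by rewrite big_nil; apply: Mspan_zero.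
rewrite big_cons; apply: Mspan_add; last first.
  by apply: IHs => q hq; apply: hs; rewrite inE hq orbT.
have [|f' [hf' hn ->]] := hs r; first by rewrite inE eqxx.
by apply/span_mulr/span_mull; rewrite -muv_base //; apply: Mspan_muv;
  rewrite ?cnt_base //; apply: ballot_base.
Qed.

(** With f = 0 the empty product 1 is among the generators, so the ideal is the whole algebra. *)
Lemma muv_spanT a : muv_span 0 a.
Proof.
have := cups_ideal_span (ideal_gen_mul 1 a (@cups_ideal_cups 0 0 isT isT)).
by rewrite /cups big_geq // !mul1r.
Qed.

End Spanning.

(** * Tableaux as ballot words *)

Section TableauWords.
Variable n : nat.

(** The cut-off at n makes the infinite word depend on the tableau alone, so that equal tableaux are
    detected by equality of words. *)
Definition tword (lam : tlpart n) (t : tableau lam) : word := fun j =>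
  (j < n)%N && ((path_at (val t) j).1 != (path_at (val t) j.+1).1).

Section OneTableau.
Variables (lam : tlpart n) (t : tableau lam).

Lemma tableau_part k : (k <= n)%N -> part_of k (path_at (val t) k).
Proof.
by move=> hk; have /and4P[/forallP h _ _ _] := valP t; apply: (h (Ordinal (hk : (k < n.+1)%N))).
Qed.

Lemma tableau_arrow k : (k < n)%N -> parrow (path_at (val t) k) (path_at (val t) k.+1).
Proof. by move=> hk; have /and4P[_ _ /forallP h _] := valP t; apply: (h (Ordinal hk)). Qed.

Lemma tableau_last : path_at (val t) n = part_pair lam.
Proof. by have /and4P[_ _ _ /eqP] := valP t. Qed.

Lemma tableau_first : path_at (val t) 0 = (0, 0)%N.
Proof. by have /and4P[_ /eqP] := valP t. Qed.

Lemma cnt_tword k : (k <= n)%N -> cnt (tword t) k = (path_at (val t) k).1.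
Proof.
elim: k => [|k IH] hk; first by rewrite tableau_first.
rewrite cntS IH ?(ltnW hk) // /tword hk andTb.
by case/orP: (tableau_arrow hk) => /andP[/eqP <- _]; rewrite ?eqxx ?addn0 //; lia.
Qed.

Lemma cnt_tword_last : cnt (tword t) n = (part_pair lam).1.
Proof. by rewrite cnt_tword // tableau_last. Qed.

Lemma ballot_tword : ballot n (tword t).
Proof.
by move=> k hk; rewrite cnt_tword //; have := tableau_part hk; rewrite /part_of; lia.
Qed.

Lemma tword_out j : (n <= j)%N -> tword t j = false.
Proof. by rewrite /tword ltnNge => ->. Qed.

End OneTableau.

Lemma part_pair_inj (lam mu : tlpart n) : (part_pair lam).1 = (part_pair mu).1 -> lam = mu.
Proof.
case: lam mu => [[i j] hij] [[k l] hkl]; rewrite /part_pair /= => e.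
have eik : i = k by apply: val_inj.
have ejl : j = l by apply: val_inj; move: hij hkl; rewrite /part_of /= e; lia.
by apply: val_inj; rewrite /= eik ejl.
Qed.

Lemma tword_shape (lam mu : tlpart n) (t : tableau lam) (s : tableau mu) :
  tword t = tword s -> lam = mu.
Proof. by move=> e; apply: part_pair_inj; rewrite -(cnt_tword_last t) e cnt_tword_last. Qed.

Lemma tword_inj (lam : tlpart n) : injective (@tword lam).
Proof.
move=> t s e; apply: val_inj; apply: eq_from_tnth => i.
rewrite !(tnth_nth (ord0, ord0)).
have hi : (i <= n)%N by rewrite -ltnS.
have := tableau_part t hi; have := tableau_part s hi.
have := cnt_tword t hi; rewrite e cnt_tword // /part_of /path_at /=.
set p := nth _ _ _; set q := nth _ _ _ => e1 e2 e3.
rewrite [p]surjective_pairing [q]surjective_pairing.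
by congr (_, _); apply: val_inj; rewrite /=; lia.
Qed.

Lemma part_exists f : (2 * f <= n)%N -> exists lam : tlpart n, (part_pair lam).1 = f.
Proof.
move=> hf; have h1 : (f < n.+1)%N by lia.
have h2 : (n - 2 * f < n.+1)%N by lia.
have h : part_of n (val (Ordinal h1), val (Ordinal h2)) by rewrite /part_of /=; lia.
by exists (Sub (Ordinal h1, Ordinal h2) h); rewrite /part_pair SubK.
Qed.

Lemma part_pairP (lam : tlpart n) :
  ((part_pair lam).2 + 2 * (part_pair lam).1 = n)%N.
Proof. by case: lam => [[i j] h]; apply/eqP. Qed.

Lemma tableau_of_word (lam : tlpart n) w : ballot n w -> cnt w n = (part_pair lam).1 ->
  exists t : tableau lam, forall j, (j < n)%N -> tword t j = w j.
Proof.
move=> bw cw.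
pose T : n.+1.-tuple ('I_n.+1 * 'I_n.+1) :=
  [tuple (inord (cnt w k), inord (k - 2 * cnt w k)) | k < n.+1].
have TE k : (k <= n)%N -> path_at T k = (cnt w k, k - 2 * cnt w k)%N.
  move=> hk; have bk := bw k hk.
  rewrite /path_at -[k]/(val (Ordinal (hk : (k < n.+1)%N))) -tnth_nth tnth_mktuple /=.
  by rewrite !inordK //; lia.
have hT : is_tableau lam T.
  apply/and4P; split.
  - apply/forallP => k; rewrite TE; last by rewrite -ltnS.
    by have := bw k; rewrite -ltnS ltn_ord /part_of /= => /(_ isT); lia.
  - by rewrite TE.
  - apply/forallP => k; have hk := ltn_ord k; rewrite !TE //; last by apply: ltnW.
    have := bw k (ltnW hk); have := bw k.+1 hk; rewrite /parrow /=.
    by case: (w k); rewrite ?addn1 ?addn0 ?eqxx /=; lia.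
  - rewrite TE // cw -[X in (_, X - _)%N](part_pairP lam) addnK.
    by rewrite -surjective_pairing.
exists (Sub T hT) => j hj; rewrite /tword SubK !TE ?hj //=; last by apply: ltnW.
by case: (w j); lia.
Qed.

Lemma TLvE (lam : tlpart n) (t : tableau lam) :
  TLv t = vword (fun i => TLgen n i.+1) (tword t) n.
Proof.
rewrite /TLv; set g := fun i => _.
suff H k : (k <= n)%N -> TLv_upto n (path_at (val t)) k = vword g (tword t) k by apply: H.
elim: k => // k IH hk.
have -> : TLv_upto n (path_at (val t)) k.+1 =
    if (path_at (val t) k).1 == (path_at (val t) k.+1).1
    then TLv_upto n (path_at (val t)) k
    else TLw n (2 * (path_at (val t) k.+1).1) k.+1 * TLv_upto n (path_at (val t)) k by [].
rewrite IH ?(ltnW hk) //.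
have bk := ballot_tword t hk; have ck := cnt_tword t hk.
rewrite [RHS]/= -ck cntS -(cnt_tword t (ltnW hk)).
rewrite cntS in bk; case: (tword t k) bk => bk; last by rewrite addn0 eqxx.
rewrite ifF; last by lia.
(* The shift by one comes from [g i] being e_(i+1). By the ballot condition the second case is 2f =
   k + 1, where both products are empty. *)
rewrite addn1 mulnS; congr (_ * _); rewrite /TLw; case: ltnP => hkk.
  by rewrite add2n big_add1.
rewrite /seg [RHS]big_geq; last by lia.
by rewrite /index_iota (_ : _ - k.+1 = 0)%N ?big_nil //; lia.
Qed.

Lemma TLvstarE (lam : tlpart n) (t : tableau lam) :
  TLvstar t = vstar (fun i => TLgen n i.+1) (tword t) n.
Proof.
rewrite /TLvstar; set g := fun i => _.
suff H k : (k <= n)%N -> TLvstar_upto n (path_at (val t)) k = vstar g (tword t) k by apply: H.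
elim: k => // k IH hk.
have -> : TLvstar_upto n (path_at (val t)) k.+1 =
    if (path_at (val t) k).1 == (path_at (val t) k.+1).1
    then TLvstar_upto n (path_at (val t)) k
    else TLvstar_upto n (path_at (val t)) k * TLw n k.+1 (2 * (path_at (val t) k.+1).1) by [].
rewrite IH ?(ltnW hk) //.
have bk := ballot_tword t hk; have ck := cnt_tword t hk.
rewrite [RHS]/= -ck cntS -(cnt_tword t (ltnW hk)).
rewrite cntS in bk; case: (tword t k) bk => bk; last by rewrite addn0 eqxx.
rewrite ifF; last by lia.
rewrite addn1 mulnS add2n; congr (_ * _); rewrite /TLw ifF; last by lia.
rewrite /rseg /index_iota subSS -[_.+2]add1n iotaDl -map_rev big_map.
by apply: eq_bigr => j _.
Qed.

Lemma TLmuvE (lam : tlpart n) (u v : tableau lam) :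
  TLmuv u v = muv n (fun i => TLgen n i.+1) (tword u) (tword v).
Proof. by rewrite /TLmuv /muv TLvE TLvstarE cnt_tword_last. Qed.

End TableauWords.

(** * Linear combinations and the ideal of larger shapes *)

Section LinearCombinations.
Variables (R : comNzRingType) (V : lmodType R) (I : finType) (F : I -> V).
Implicit Types (a c : I -> R).

Lemma lincomb_pick j : \sum_i (i == j)%:R *: F i = F j.
Proof.
rewrite (bigD1 j) //= eqxx scale1r big1 ?addr0 // => i /negPf ->.
exact: scale0r.
Qed.

Lemma lincomb0 : \sum_i (0 : R) *: F i = 0.
Proof. by rewrite big1 // => i _; apply: scale0r. Qed.

Lemma lincombD a c : \sum_i (a i + c i) *: F i = \sum_i a i *: F i + \sum_i c i *: F i.
Proof. by rewrite -big_split; apply: eq_bigr => i _; rewrite scalerDl. Qed.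

Lemma lincombZ k a : \sum_i (k * a i) *: F i = k *: \sum_i a i *: F i.
Proof. by rewrite scaler_sumr; apply: eq_bigr => i _; rewrite scalerA. Qed.

Lemma lincombD_sub x y a c :
  (x - \sum_i a i *: F i) + (y - \sum_i c i *: F i) =
  x + y - \sum_i (a i + c i) *: F i.
Proof. by rewrite lincombD opprD addrACA. Qed.

Lemma lincombZ_sub k x a :
  k *: (x - \sum_i a i *: F i) = k *: x - \sum_i (k * a i) *: F i.
Proof. by rewrite lincombZ scalerBr. Qed.

End LinearCombinations.

(** Carries an expansion of m_lambda v_u b to one of m_su b, with l = v_s^*; the trailing 1 matches
    the two-sided closure [check_idealM]. *)
Lemma lincomb_mull (R : comNzRingType) (A : algType R) (I : finType)
    (a : I -> R) (l m v b : A) (F : I -> A) :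
  l * (m * v * b - \sum_i a i *: (m * F i)) * 1 =
  l * m * v * b - \sum_i a i *: (l * m * F i).
Proof.
rewrite mulr1 mulrBr mulr_sumr !mulrA; congr (_ - _); apply: eq_bigr => i _.
by rewrite -scalerAr mulrA.
Qed.

Section CheckIdeal.
Variables (n : nat) (lam : tlpart n).

Lemma check_ideal0 : TLcheck_ideal lam 0.
Proof. by exists (fun=> 0) => [mu _|]; [apply: ideal_gen0|rewrite big1]. Qed.

Lemma check_idealD a b :
  TLcheck_ideal lam a -> TLcheck_ideal lam b -> TLcheck_ideal lam (a + b).
Proof.
move=> [f hf ->] [h hh ->]; exists (fun mu => f mu + h mu); last exact/esym/big_split.
by move=> mu hmu; apply: ideal_genD; [apply: hf|apply: hh].
Qed.

Lemma check_idealM a b c : TLcheck_ideal lam b -> TLcheck_ideal lam (a * b * c).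
Proof.
move=> [f hf ->]; exists (fun mu => a * f mu * c).
  by move=> mu hmu; apply: ideal_gen_mul; apply: hf.
by rewrite mulr_sumr mulr_suml.
Qed.

Lemma check_ideal_cell mu a : psdom mu lam -> TLcell_ideal mu a -> TLcheck_ideal lam a.
Proof.
move=> hmu ha; exists (fun nu => if nu == mu then a else 0).
  by move=> nu _; case: eqP => [->|_] //; apply: ideal_gen0.
by rewrite (bigD1 mu) //= eqxx big1 ?addr0 // => nu /andP[_ /negPf ->].
Qed.

Lemma check_ideal_cups : let f := (part_pair lam).1 in
  (2 * f.+1 <= n)%N -> TLcheck_ideal lam (cups (fun i => TLgen n i.+1) f.+1).
Proof.
move=> f hf; have [mu hmu] := part_exists hf.
apply: (@check_ideal_cell mu).
  rewrite /psdom /pdom hmu leqnSn /=; apply/eqP => e.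
  by move: hmu; rewrite e -/f; lia.
exists [:: (1, TLm mu, 1)]; first by move=> r; rewrite inE => /eqP ->.
by rewrite big_seq1 mul1r mulr1 /TLm hmu.
Qed.

End CheckIdeal.

(** * The three statements for the Temperley-Lieb algebra *)

Section Assembly.
Variable n : nat.
Local Notation g := (fun i => TLgen n i.+1).

Lemma TLgenS_sqr i : (i.+1 < n)%N -> g i * g i = 'X *: g i.
Proof. by move=> hi; exact: (@TLgen_sqr n i.+1). Qed.

Lemma TLgenS_braid i j : (i.+1 < n)%N -> (j.+1 < n)%N ->
  (j == i.+1) || (i == j.+1) -> g i * g j * g i = g i.
Proof. by move=> hi hj hij; apply: (@TLgen_braid n i.+1 j.+1) => //; rewrite !eqSS. Qed.

Lemma TLgenS_comm i j : (i.+1 < n)%N -> (j.+1 < n)%N ->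
  (i.+1 < j)%N || (j.+1 < i)%N -> GRing.comm (g i) (g j).
Proof. by move=> hi hj hij; apply: (@TLgen_comm n i.+1 j.+1) => //; lia. Qed.

Lemma TL_ind_shift (P : TL n -> Prop) :
  P 1 -> (forall u v, P u -> P v -> P (u + v)) ->
  (forall c u, P u -> P (c *: u)) ->
  (forall i u, (i.+1 < n)%N -> P u -> P (g i * u)) -> forall u, P u.
Proof. by move=> P1 PD PZ PM; apply: TL_ind => // -[//|i] u; apply: PM. Qed.

Lemma TLstarD u v : TLstar (u + v) = TLstar u + TLstar v :> TL n.
Proof. exact: linearD. Qed.

Lemma TLstarZ c u : TLstar (c *: u) = c *: TLstar u :> TL n.
Proof. exact: linearZ. Qed.

Lemma TLstarg i : (i.+1 < n)%N -> TLstar (g i) = g i.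
Proof. by move=> hi; exact: (@TLstar_gen n i.+1). Qed.

Lemma TLstarK : involutive (@TLstar n).
Proof.
exact: (starK TL_ind_shift (@TLstar1 n) TLstarD TLstarZ (@TLstarM n) TLstarg).
Qed.

Lemma TLstar_muv (lam : tlpart n) (u v : tableau lam) : TLstar (TLmuv u v) = TLmuv v u.
Proof.
rewrite !TLmuvE.
apply: (star_muv TL_ind_shift (@TLstar1 n) TLstarD TLstarZ (@TLstarM n) TLstarg TLgenS_comm).
  exact: ballot_tword.
by rewrite !cnt_tword_last.
Qed.

Lemma TLmuv_spans a : exists c : muv_index n -> {poly int},
  a = \sum_i c i *: TLmuv_family i.
Proof.
have := muv_spanT TLgenS_sqr TLgenS_braid TLgenS_comm TL_ind_shift (@TLstar1 n) TLstarD TLstarZ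
  (@TLstarM n) TLstarg a.
elim=> {a} [u v bu bv cuv _|a b _ [c ->] _ [d ->]|k a _ [c ->]|].
- have [lam hlam] := part_exists (bu n (leqnn n)).
  have [s hs] := tableau_of_word bu (esym hlam).
  have [t ht] := tableau_of_word bv (etrans (esym cuv) (esym hlam)).
  pose i0 : muv_index n := Tagged (fun lam => (tableau lam * tableau lam)%type) (s, t).
  exists (fun i => (i == i0)%:R); apply: etrans (esym (lincomb_pick _ i0)).
  rewrite /TLmuv_family /= TLmuvE /muv cnt_tword_last hlam.
  by rewrite (eq_vword _ ht) (eq_vstar _ hs).
- by exists (fun i => c i + d i); apply/esym/lincombD.
- by exists (fun i => k * c i); apply/esym/lincombZ.
- by exists (fun=> 0); apply/esym/lincomb0.
Qed.

Lemma TLmuv_free (c : muv_index n -> {poly int}) :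
  \sum_i c i *: TLmuv_family i = 0 -> forall i, c i = 0.
Proof.
have [S [t [t' [tV t'V tD S_inj]]]] := companion_pair.
pose u (i : muv_index n) := tword (tagged i).1.
pose v (i : muv_index n) := tword (tagged i).2.
move=> hc.
have act_gen i phi : (i.+1 < n)%N -> TLact t t' (g i) phi = hop t t' i phi.
  by move=> hi; apply: TLact_gen.
have key := (muv_free tV t'V TL_ind_shift (@TLact1 n S t t' tV t'V tD) (@TLactD n S t t' tV t'V tD)
  (@TLactZ n S t t' tV t'V tD) (@TLactM n S t t' tV t'V tD) act_gen (@TLstar1 n) TLstarD TLstarZ
  (@TLstarM n) TLstarg TLgenS_comm S_inj).
apply: (key _ u v c) => [i|i|i|i j|i j|i j|].
- exact: ballot_tword.
- exact: ballot_tword.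
- by rewrite !cnt_tword_last.
- exact: tword_out.
- exact: tword_out.
- case: i j => [lam [a b]] [mu [a' b']]; rewrite /u /v /= => eu ev.
  (* The shapes must be identified first, since the types of the tableaux depend on them. *)
  have elam := tword_shape eu; case: mu / elam a' b' eu ev => a' b' /tword_inj -> /tword_inj ->.
  by [].
- by rewrite -[RHS]hc; apply: eq_bigr => i _; rewrite /TLmuv_family TLmuvE.
Qed.

(** The element m_lambda v_u b is expanded before v_s^* is applied on the left, which is why the
    coefficients do not depend on s. *)
Lemma TLmuv_mulr (b : TL n) (lam : tlpart n) (u : tableau lam) :
  exists a : tableau lam -> {poly int}, forall s : tableau lam,
    TLcheck_ideal lam (TLmuv s u * b - \sum_(v : tableau lam) a v *: TLmuv s v).
Proof.
pose J := @TLcheck_ideal n lam; set f := (part_pair lam).1.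
have JM : forall a b c, J b -> J (a * b * c) := @check_idealM n lam.
have JZ k a : J a -> J (k *: a).
  by move=> /(JM k%:A a 1); rewrite mulr1 mulr_algl.
have [d] : exists d, cell_span n g J f d (TLm lam * TLv u * b).
  have JC : (2 * f.+1 <= n)%N -> J (cups g f.+1) := @check_ideal_cups n lam.
  have key := @cell_span_mul _ _ _ n g TLgenS_sqr TLgenS_braid TLgenS_comm TL_ind_shift J f.
  apply: (key _ b JM JC).
  exists (defect n (tword u)).
  have -> : TLm lam * TLv u = yword g (tword u) n.
    have := cups_vword TLgenS_comm (ballot_tword u) (leqnn n).
    by rewrite cnt_tword_last TLvE.
  by apply: Span_word => //; [exact: ballot_tword|exact: cnt_tword_last].
suff H x : cell_span n g J f d x -> exists a : tableau lam -> {poly int},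
    J (x - \sum_v a v *: (TLm lam * TLv v)).
  move=> /H[a ha]; exists a => s.
  exact: (eq_ind _ J (JM (TLvstar s) _ 1 ha) _ (lincomb_mull _ _ _ _ _ _)).
have subE (y z w : TL n) : J w -> w = y - z -> J (y - z) by move=> hw <-.
elim=> {x} [w bw cw _|x hx|x y _ [a ha] _ [c hc]|k x _ [a ha]].
- have [t ht] := tableau_of_word bw cw; exists (fun v => (v == t)%:R).
  apply: (subE _ _ 0); first exact: check_ideal0.
  have e : yword g w n = TLm lam * TLv t.
    rewrite TLvE (eq_vword _ ht).
    by have := cups_vword TLgenS_comm bw (leqnn n); rewrite cw.
  by rewrite e; apply/esym/eqP; rewrite subr_eq0; apply/eqP/esym/lincomb_pick.
- exists (fun=> 0); apply: (subE _ _ x) => //.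
  exact: etrans (esym (subr0 x)) (congr1 (fun z => x - z) (esym (lincomb0 _))).
- exists (fun v => a v + c v); apply: (subE _ _ _ (check_idealD ha hc)).
  exact: lincombD_sub.
- exists (fun v => k * a v); apply: (subE _ _ _ (JZ k _ ha)).
  exact: lincombZ_sub.
Qed.

End Assembly.

Theorem lemma2p3 (n : nat) (hn : (0 < n)%N) :
  [/\ freely_generated (@TLmuv_family n),
      exists star : {linear TL n -> TL n},
        [/\ forall (lam : tlpart n) (u v : tableau lam),
              star (TLmuv u v) = TLmuv v u,
            forall f : {linear TL n -> TL n},
              (forall (lam : tlpart n) (u v : tableau lam),
                 f (TLmuv u v) = TLmuv v u) ->
              f =1 star,
            anti_involution star,
            forall i : nat, (0 < i < n)%N -> star (TLgen n i) = TLgen n i &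
            forall f : {linear TL n -> TL n},
              anti_involution f ->
              (forall i : nat, (0 < i < n)%N -> f (TLgen n i) = TLgen n i) ->
              f =1 star] &
      forall (b : TL n) (lam : tlpart n) (u : tableau lam),
        exists a : tableau lam -> {poly int},
          forall s : tableau lam,
            TLcheck_ideal lam
              (TLmuv s u * b - \sum_(v : tableau lam) a v *: TLmuv s v)].
Proof.
split; last exact: TLmuv_mulr.
  by split; [apply: TLmuv_spans|apply: TLmuv_free].
exists (@TLstar n); split.
- exact: TLstar_muv.
- move=> f hf a; have [c ->] := TLmuv_spans a.
  rewrite !linear_sum; apply: eq_bigr => i _; rewrite !linearZ.
  by congr (_ *: _); rewrite [LHS]hf [RHS]TLstar_muv.
- by split; [apply: TLstar1|apply: TLstarM|apply: TLstarK].
- exact: TLstar_gen.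
- move=> f [f1 fM _] fg; apply: TL_ind => [|a b ha hb|c a ha|i a hi ha].
  + exact: etrans f1 (esym (@TLstar1 n)).
  + by rewrite !linearD ha hb.
  + by rewrite !linearZ ha.
  + by rewrite fM fg // ha [RHS]TLstarM TLstar_gen.
Qed.
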